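(* Let $\Omega\subset\mathbb R^n$ be a bounded open domain with smooth boundary and let $u$ be a continuous function on $\overline\Omega$ with upper contact set $\Gamma^+$. Suppose that there exists an open connected subset $V$ of $\Omega$ such that $\Gamma^+\subset V$ and $u\in C(\overline\Omega)\cap C^2(V)$. Let $L$ be an elliptic operator with $c\le0$, and suppose that $Lu\ge f$ on $V$ with $$\frac{|b|}{\mathfrak D^*},\ \frac{f}{\mathfrak D^*}\in L^n(\Gamma^+).$$ Then $$\sup_\Omega u\le\sup_{\partial\Omega}u^++C\cdot\mathrm{diam}(\Omega)\cdot\left\|\frac{f^-}{\mathfrak D^*}\right\|_{L^n(\Gamma^+)},$$ with $$C=C\left(n,\left\|\frac{|b|}{\mathfrak D^*}\right\|_{L^n(\Gamma^+)}\right)$$ a constant depending only on the indicated quantities.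
   Context: $L=\sum_{i,j=1}^na_{ij}(x)D_{ij}+\sum_{i=1}^nb_i(x)D_i+c(x)$ is a second order differential operator (defined on $V$) with $a_{ij}=a_{ji}$, $a_{ij}\in L^\infty_{loc}$ and $b_i,c\in L^\infty$; $b=(b_1,\dots,b_n)$. $L$ is elliptic if for every $x$ there is $\lambda(x)>0$ with $\sum a_{ij}(x)\xi_i\xi_j\ge\lambda(x)|\xi|^2$ for all $\xi\in\mathbb R^n$. $\mathfrak D^*:=(\det(a_{ij}))^{1/n}$. The upper contact set of $u\in C(\overline\Omega)$ is $$\Gamma^+=\{y\in\Omega:\ \exists\,p_y\in\mathbb R^n\text{ such that }u(x)\le u(y)+p_y\cdot(x-y)\ \ \forall x\in\Omega\}.$$ $u^+=\max(u,0)$, $f^-=\max(-f,0)$. *)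

(* Defs.v *)
From HB Require Import structures.
From mathcomp Require Import all_boot all_order all_algebra.
From mathcomp Require Import all_classical all_reals all_analysis.

Set Implicit Arguments.
Unset Strict Implicit.
Unset Printing Implicit Defensive.

Import Order.TTheory GRing.Theory Num.Theory.
Import numFieldNormedType.Exports.

Local Open Scope classical_set_scope.
Local Open Scope ring_scope.

(* R^n is ['rV[R]_n]. Its library norm is the sup norm, which gives the right
   topology; Euclidean lengths are written with [enorm]. *)
Section Euclidean.
Context {R : realType} {n : nat}.
Implicit Types (x y : 'rV[R]_n) (A : set 'rV[R]_n).

Definition dotv x y : R := \sum_(i < n) x ord0 i * y ord0 i.

Definition enorm x : R := Num.sqrt (dotv x x).

Definition ediam A : R :=
  sup [set r | exists x y, [/\ A x, A y & r = enorm (x - y)]].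

Definition boundary A : set 'rV[R]_n := closure A `\` A°.

End Euclidean.

Section Smoothness.
Context {R : realType} {n : nat}.
Implicit Types (f : 'rV[R]_n -> R) (U : set 'rV[R]_n).

Definition partial (i : 'I_n) f : 'rV[R]_n -> R :=
  fun x => 'D_(delta_mx ord0 i) f x.

(* Only meant for open [U]: the values of [f] outside [U] are then
   irrelevant. *)
Fixpoint Ck_on (k : nat) U f : Prop :=
  (forall x, U x -> {for x, continuous f}) /\
  if k is k'.+1 then
    forall i : 'I_n,
      (forall x, U x -> derivable f x (delta_mx ord0 i)) /\
      Ck_on k' U (partial i f)
  else True.

Definition Cinfty_on U f : Prop := forall k, Ck_on k U f.

End Smoothness.

(* Local flattening of the boundary: near each boundary point a smooth
   diffeomorphism [psi] (with inverse [phi]) of an open set [U] onto an open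
   set takes Omega to the half space {y_n > 0} and its boundary to
   {y_n = 0}. *)
Definition smooth_boundary {R : realType} {n : nat}
    (Omega : set 'rV[R]_n.+1) : Prop :=
  forall x0, boundary Omega x0 ->
  exists (U : set 'rV[R]_n.+1) (psi phi : 'rV[R]_n.+1 -> 'rV[R]_n.+1),
  [/\ open U /\ U x0,
      open (psi @` U) /\ (forall x, U x -> phi (psi x) = x),
      forall i, Cinfty_on U (fun x => psi x ord0 i),
      forall i, Cinfty_on (psi @` U) (fun y => phi y ord0 i) &
      forall x, U x ->
        (Omega x <-> 0 < psi x ord0 ord_max) /\
        (boundary Omega x <-> psi x ord0 ord_max = 0)].

(* n-dimensional Lebesgue outer measure. The dimension is written [n.+1]
   because in dimension 0 every box would have volume 1. *)
Section LebesgueOuterMeasure.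
Context {R : realType} {n : nat}.
Local Open Scope ereal_scope.

Definition box (ab : 'rV[R]_n.+1 * 'rV[R]_n.+1) : set 'rV[R]_n.+1 :=
  [set x | forall i, (ab.1 ord0 i < x ord0 i <= ab.2 ord0 i)%R].

Definition box_volume (ab : 'rV[R]_n.+1 * 'rV[R]_n.+1) : R :=
  (\prod_(i < n.+1) Num.max (ab.2 ord0 i - ab.1 ord0 i) 0)%R.

Definition box_cover (A : set 'rV[R]_n.+1) :
    set (nat -> 'rV[R]_n.+1 * 'rV[R]_n.+1) :=
  [set B | A `<=` \bigcup_k box (B k)].

Definition lebesgue_outer (A : set 'rV[R]_n.+1) : \bar R :=
  ereal_inf [set \sum_(k <oo) (box_volume (B k))%:E | B in box_cover A].

Let vol_ge0 ab : 0 <= (box_volume ab)%:E.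
Proof.
by rewrite lee_fin; apply: prodr_ge0 => i _; rewrite le_max lexx orbT.
Qed.

Lemma lebesgue_outer_ge0 A : 0 <= lebesgue_outer A.
Proof.
by apply: le_ereal_inf_tmp => _ [B _ <-]; apply: nneseries_ge0 => k _ _.
Qed.

Lemma lebesgue_outer0 : lebesgue_outer set0 = 0.
Proof.
apply/eqP; rewrite eq_le lebesgue_outer_ge0 andbT.
apply: ereal_inf_lbound; exists (fun=> (0%R, 0%R)) => //.
apply: eseries0 => k _ _; rewrite /box_volume big_ord_recl /= subrr.
by rewrite maxxx mul0r.
Qed.

Lemma le_lebesgue_outer : {homo lebesgue_outer : A B / A `<=` B >-> A <= B}.
Proof.
move=> A B AB; apply/ereal_inf_le_tmp => _ [C BC <-].
by exists C => //; exact: subset_trans BC.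
Qed.

Lemma lebesgue_outer_sigma_subadditive : sigma_subadditive lebesgue_outer.
Proof.
move=> A; have [[i ioo]|] := pselect (exists i, lebesgue_outer (A i) = +oo).
  rewrite (eseries_pinfty _ _ ioo) ?leey// => k _.
  by rewrite -ltNye (lt_le_trans _ (lebesgue_outer_ge0 _)).
rewrite -forallNE => Aoo.
suff add2e (e : {posnum R}) :
    lebesgue_outer (\bigcup_n A n) <=
    \sum_(i <oo) lebesgue_outer (A i) + e%:num%:E.
  by apply/lee_addgt0Pr => _/posnumP[].
rewrite (le_trans _ (epsilon_trick _ _ _))//; last first.
  by move=> k; exact: lebesgue_outer_ge0.
pose P k B := box_cover (A k) B /\
  \sum_(j <oo) (box_volume (B j))%:E <=
  lebesgue_outer (A k) + (e%:num / (2 ^ k.+1)%:R)%:E.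
have [G PG] : {G & forall k, P k (G k)}.
  apply: (@choice _ _ P) => k; rewrite /P.
  have fin : lebesgue_outer (A k) \is a fin_num.
    by rewrite ge0_fin_numE ?lebesgue_outer_ge0// lt_neqAle leey andbT; apply/eqP.
  have ek : (0 < e%:num / (2 ^ k.+1)%:R :> R)%R by [].
  have [_ [B AB <-] xS] := lb_ereal_inf_adherent ek fin.
  by exists B; split => //; exact/ltW.
pose v (x : nat * nat) := (box_volume (uncurry G x))%:E.
have v_ge0 x : 0 <= v x by exact: vol_ge0.
apply: (@le_trans _ _ (\esum_(i in setT) v i)).
  apply: ereal_inf_lbound => /=.
  have /card_esym/ppcard_eqP[f] := card_nat2.
  exists (uncurry G \o f).
    move=> t [i _ /(PG i).1[j _ Bijt]]; exists (f^-1%FUN (i, j)) => //=.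
    by rewrite invK ?inE.
  rewrite -(esum_pred_image v _ xpredT) ?[fun=> _]set_true//.
  by rewrite image_eq.
rewrite (_ : esum _ _ = \sum_(i <oo) \sum_(j <oo) v (i, j)); last first.
  pose J : nat -> set (nat * nat) := fun i => [set (i, j) | j in setT].
  rewrite (_ : setT = \bigcup_k J k); last first.
    by rewrite predeqE => -[a b]; split => // _; exists a => //; exists b.
  rewrite esum_bigcupT /=; last 2 first.
    - apply/trivIsetP => i j _ _ ij.
      rewrite predeqE => -[k m] /=; split => //= -[] [_] _ [<-{k} _].
      by move=> [m' _] [] /esym/eqP; rewrite (negbTE ij).
    - by move=> x; exact: vol_ge0.
  rewrite -(image_id [set: nat]) -fun_true esum_pred_image//; last first.
    by move=> k _; apply: esum_ge0 => x _; exact: vol_ge0.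
  apply: eq_eseriesr => /= j _.
  rewrite -(esum_pred_image v (pair j) predT)//=; last first.
    by move=> ? ? _ _; exact: (@can_inj _ _ _ snd).
  by congr esum; rewrite predeqE => -[a b]; split; move=> [i _ <-]; exists i.
apply: lee_nneseries => [i _ _|i _].
- by apply: nneseries_ge0 => k _ _; exact: vol_ge0.
- exact: (PG i).2.
Qed.

HB.instance Definition _ := isOuterMeasure.Build R 'rV[R]_n.+1 lebesgue_outer
  lebesgue_outer0 lebesgue_outer_ge0 le_lebesgue_outer
  lebesgue_outer_sigma_subadditive.

End LebesgueOuterMeasure.

(* R^n with the sigma-algebra of Lebesgue (Caratheodory) measurable sets. *)
Definition leb_rV (R : realType) (n : nat) :=
  caratheodory_type (@lebesgue_outer R n).

HB.instance Definition _ (R : realType) (n : nat) :=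
  Measurable.on (leb_rV R n).

Definition lebesgue_rV (R : realType) (n : nat) : set (leb_rV R n) -> \bar R :=
  @lebesgue_outer R n.
Arguments lebesgue_rV : clear implicits.

HB.instance Definition _ (R : realType) (n : nat) :=
  isMeasure.Build _ _ _ (lebesgue_rV R n)
    (@caratheodory_measure0 R _ (@lebesgue_outer R n))
    (@caratheodory_measure_ge0 R _ (@lebesgue_outer R n))
    (@caratheodory_measure_sigma_additive R _ (@lebesgue_outer R n)).

Section LebesgueSpaces.
Context {R : realType} {n : nat}.
Implicit Types (p : \bar R) (A : set 'rV[R]_n.+1) (g : 'rV[R]_n.+1 -> R).

Definition in_Lp p A g : Prop :=
  measurable_fun (A : set (leb_rV R n)) (g : leb_rV R n -> R) /\
  finite_norm (lebesgue_rV R n) p (g \_ A).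

Definition Lp_norm p A g : R :=
  fine (Lnorm (lebesgue_rV R n) p (EFin \o (g \_ A))).

Definition in_Linfty_loc A g : Prop :=
  forall K, compact K -> K `<=` A -> in_Lp +oo%E K g.

End LebesgueSpaces.

Section Operator.
Context {R : realType} {n : nat}.
Implicit Types (a : 'rV[R]_n -> 'M[R]_n) (b : 'rV[R]_n -> 'rV[R]_n)
  (c u : 'rV[R]_n -> R) (V Omega : set 'rV[R]_n).

Definition Lop a b c u : 'rV[R]_n -> R := fun x =>
  \sum_(i < n) \sum_(j < n) a x i j * partial i (partial j u) x +
  \sum_(i < n) b x ord0 i * partial i u x + c x * u x.

Definition elliptic_on V a : Prop :=
  forall x, V x -> exists lambda : R, 0 < lambda /\
  forall xi : 'rV[R]_n,
    lambda * enorm xi ^+ 2 <=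
    \sum_(i < n) \sum_(j < n) a x i j * xi ord0 i * xi ord0 j.

Definition Dstar a : 'rV[R]_n -> R := fun x => \det (a x) `^ (n%:R^-1).

Definition upper_contact_set Omega u : set 'rV[R]_n :=
  [set y | Omega y /\ exists p : 'rV[R]_n,
     forall x, Omega x -> u x <= u y + dotv p (x - y)].

End Operator.

Definition pospart {R : realType} {T : Type} (f : T -> R) : T -> R :=
  fun x => Num.max (f x) 0.

Definition negpart {R : realType} {T : Type} (f : T -> R) : T -> R :=
  fun x => Num.max (- f x) 0.

(* Main.v *)
Require Import Defs.
From mathcomp Require Import all_boot all_order all_fingroup all_algebra.
From mathcomp Require Import all_classical all_reals all_analysis.
From mathcomp Require Import ring lra zify.
Set Implicit Arguments.
Unset Strict Implicit.
Unset Printing Implicit Defensive.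
Import Order.TTheory GRing.Theory Num.Theory.
Import numFieldNormedType.Exports.
Import measurable_realfun.
Local Open Scope classical_set_scope.
Local Open Scope ring_scope.

(** The Alexandrov-Bakelman-Pucci estimate.

    Suppose that [u x0] exceeds the boundary values [S] by more than
    [rho * diam Omega]. Then every slope [p] with [|p| <= rho] is the slope of a
    supporting plane: [u - p . x] is maximal at an interior point [y]
    ([exists_contact]), which lies in the contact set, where [u y > S >= 0] and
    [p] is the gradient of [u] ([contact_gradient]). So the gradient map sends
    the contact set onto a set containing the ball of radius [rho], and [rho] is
    controlled by comparing volumes.

    Volumes are compared by half of the change of variables formula,
    [|G(E)| <= \int_E |det DG|] for a [C^1] map [G] ([area_inequality]). At a
    contact point the Hessian of [u] is negative semidefinite
    ([contact_hessian]), so the inequality between the determinant and the trace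
    of a product of positive matrices ([det_mul_le_trace]), the differential
    inequality and [c u <= 0] bound the Jacobian of the gradient by a constant
    times [(|b| |p| / D + f^- / D) ^ n], with [p] the gradient
    ([contact_jacobian_le]).

    The factor [|p|] is dealt with on dyadic shells. Let [m > 0] be at least the
    norm of [f^- / D]. Over the cube [{p : t < p_i < 2 t}] with [t = 2 ^ k m] the
    two bounds combine, after division by [t ^ n], to a lower bound [2 ^- n] for
    the integral of a fixed function [H] over the part of the contact set whose
    gradients lie in that cube. These parts are disjoint for different [k],
    and the integral of [H] over the whole contact set is at most a constant
    depending on [n] and the norm of [|b| / D]. This limits the number of dyadic
    cubes inside the ball of radius [rho], that is, it bounds [rho / m]
    ([contact_growth]); letting [m] decrease to the norm of [f^- / D] gives the
    theorem.

    For the area inequality, the measure of the image of a cube under a linear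
    map [T] is at most [|det T|] times its volume ([image_bound_det]). By an LU
    factorisation it is enough to treat permutations, which map boxes to boxes,
    and triangular maps, which are conjugate by diagonal maps to maps arbitrarily
    close to diagonal ones. A [C^1] map is close to its linearisation on small
    cubes ([strict_diff]), and a bound for the images of cubes gives one for the
    images of all sets ([image_measure_le_of_cubes]). *)

(** * Boxes and Lebesgue outer measure *)

Section SupNorm.
Context {R : realType} {n : nat}.
Implicit Types x : 'rV[R]_n.

Lemma coord_le_norm x i : `|x ord0 i| <= `|x|.
Proof.
rewrite [leRHS]/Num.Def.normr/= mx_normrE.
exact: (le_bigmax _ (fun ij => `|x ij.1 ij.2|) (ord0, i)).
Qed.

Lemma norm_le_coord x e : 0 <= e -> (forall i, `|x ord0 i| <= e) -> `|x| <= e.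
Proof.
move=> e0 xe; rewrite [leLHS]/Num.Def.normr/= mx_normrE.
by apply: bigmax_le => // -[i j] _ /=; rewrite ord1.
Qed.

End SupNorm.

Section Boxes.
Context {R : realType} {n : nat}.
Implicit Types (x c : 'rV[R]_n.+1) (A : set 'rV[R]_n.+1).

Definition cube c (s : R) : 'rV[R]_n.+1 * 'rV[R]_n.+1 := (c, c + const_mx s).

Definition open_box (ab : 'rV[R]_n.+1 * 'rV[R]_n.+1) : set 'rV[R]_n.+1 :=
  [set x | forall i, ab.1 ord0 i < x ord0 i < ab.2 ord0 i].

Lemma box_volume_ge0 ab : 0 <= @box_volume R n ab.
Proof. by apply: prodr_ge0 => i _; rewrite le_max lexx orbT. Qed.

Lemma box_volumeE (ab : 'rV[R]_n.+1 * 'rV[R]_n.+1) :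
  (forall i, ab.1 ord0 i <= ab.2 ord0 i) ->
  box_volume ab = \prod_i (ab.2 ord0 i - ab.1 ord0 i).
Proof. by move=> h; apply: eq_bigr => i _; apply/max_idPl; rewrite subr_ge0. Qed.

Lemma cube_volume c s : 0 <= s -> box_volume (cube c s) = s ^+ n.+1.
Proof.
move=> s0; rewrite box_volumeE => [|i]; last by rewrite /= !mxE lerDl.
rewrite (eq_bigr (fun=> s)) => [|i _]; last by rewrite /= !mxE addrAC subrr add0r.
by rewrite prodr_const card_ord.
Qed.

Lemma lebesgue_outer_le (A : set 'rV[R]_n.+1) (B : nat -> _) :
  A `<=` \bigcup_k box (B k) ->
  (lebesgue_outer A <= \sum_(k <oo) (box_volume (B k))%:E)%E.
Proof. by move=> AB; apply: ereal_inf_lbound; exists B. Qed.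

Lemma empty_box (ab : 'rV[R]_n.+1 * 'rV[R]_n.+1) i :
  ab.2 ord0 i <= ab.1 ord0 i -> box ab = set0.
Proof.
move=> h; apply/seteqP; split => x //= /(_ i) /andP[h1 h2].
by have := lt_le_trans h1 (le_trans h2 h); rewrite ltxx.
Qed.

Lemma lebesgue_outer_box_le ab :
  (lebesgue_outer (box ab) <= (@box_volume R n ab)%:E)%E.
Proof.
pose B k := if k is 0%N then ab else cube 0 0.
apply: (le_trans (@lebesgue_outer_le _ B _)); first by move=> x hx; exists 0%N.
rewrite (nneseries_recl (P := predT))//=; last first.
  by move=> k _; rewrite lee_fin box_volume_ge0.
rewrite eseries_cond/= eseries0 ?addr0//; last first.
by move=> [|k] //= _ _; rewrite cube_volume// expr0n.
Qed.

Lemma prod_add_small (l : 'I_n.+1 -> R) (e : R) : 0 < e ->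
  exists2 d, 0 < d & forall t, 0 <= t -> t <= d ->
    \prod_i (l i + t) <= \prod_i l i + e.
Proof.
move=> e0; pose p : {poly R} := \prod_i ('X + (l i)%:P).
have pE t : p.[t] = \prod_i (l i + t).
  by rewrite horner_prod; apply: eq_bigr => i _; rewrite !hornerE addrC.
have /cvgrPdist_le /(_ e e0) /nbhs_ballP[d /= d0 hd] := @continuous_horner R p 0.
exists (d / 2); first exact: divr_gt0.
move=> t t0 td; have := hd t; rewrite !pE /ball/= sub0r normrN ger0_norm//.
move=> /(_ (le_lt_trans td _)); rewrite ltr_pdivrMr// ltr_pMr// ltr1n => /(_ isT).
rewrite distrC [X in _ - X](eq_bigr l) => [|i _]; last by rewrite addr0.
by rewrite -lerBlDl; apply: le_trans; exact: ler_norm.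
Qed.

Lemma lebesgue_outer_fin (I : finType) (P : pred I) (X : I -> set 'rV[R]_n.+1) :
  (lebesgue_outer (\bigcup_(i in [set i | P i]) X i) <=
   \sum_(i | P i) lebesgue_outer (X i))%E.
Proof.
apply: (@le_trans _ _ (lebesgue_outer (\big[setU/set0]_(i | P i) X i))).
  apply: le_lebesgue_outer => x [i /= Pi Xi].
  by rewrite (bigD1 i)//=; left.
elim/big_rec2: _ => [|i y1 y2 Pi h]; first by rewrite lebesgue_outer0.
by apply: (le_trans (outer_measureU2 _ _ _)); exact: leeD2l.
Qed.

End Boxes.

Section CubePrinciple.
Context {R : realType} {n : nat}.
Implicit Types (x c : 'rV[R]_n.+1) (A : set 'rV[R]_n.+1).

Lemma nat_ceil (y : R) : 0 < y -> exists j : nat, j%:R < y <= j.+1%:R.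
Proof.
move=> y0; have ex : exists j : nat, y <= j.+1%:R.
  by exists (Num.truncn y); exact: ltW (truncnS_gt y).
case: (ex_minnP ex) => j yj jmin; exists j; rewrite yj andbT.
case: j yj jmin => [//|j] _ jmin; rewrite ltNge; apply/negP => h.
by have := jmin _ h; rewrite ltnn.
Qed.

Lemma box_subset_cubes (ab : 'rV[R]_n.+1 * 'rV[R]_n.+1) (d : R) : 0 < d ->
  let m i := (Num.truncn ((ab.2 ord0 i - ab.1 ord0 i) / d)).+1 in
  let M := (\max_i m i)%N in
  box ab `<=` \bigcup_(f in [set f : {ffun 'I_n.+1 -> 'I_M} |
      f \in family (fun i => [pred j : 'I_M | (j < m i)%N])])
    box (cube (ab.1 + \row_i ((f i)%:R * d)) d).
Proof.
move=> d0 m M x xab.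
have h i : exists j : 'I_M, (j < m i)%N &&
    (j%:R * d < x ord0 i - ab.1 ord0 i <= j.+1%:R * d).
  have /andP[x1 x2] := xab i.
  have y0 : 0 < (x ord0 i - ab.1 ord0 i) / d by rewrite divr_gt0 ?subr_gt0.
  have [j /andP[j1 j2]] := nat_ceil y0.
  have jm : (j < m i)%N.
    rewrite -(ltr_nat R); apply: (lt_trans j1); apply: le_lt_trans (truncnS_gt _).
    by rewrite ler_pM2r ?invr_gt0// lerB.
  have jM : (j < M)%N by apply: (leq_trans jm); exact: leq_bigmax.
  by exists (Ordinal jM) => /=; rewrite jm /= -ltr_pdivlMr// j1/= -ler_pdivrMr.
have [f hf] := choice h.
exists [ffun i => f i] => /=.
  by apply/familyP => i; rewrite ffunE inE; have /andP[] := hf i.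
move=> i; rewrite /= !mxE ffunE; have /and3P[_ h1] := hf i.
by rewrite -natr1 mulrDl mul1r => h2; apply/andP; split; lra.
Qed.

(** Boxes are tiled by small cubes almost without waste, so a bound on the
    images of cubes propagates to a bound on the images of all sets. All
    upper bounds on the measure of an image below rest on this. *)
Lemma image_measure_le_of_cubes (G : 'rV[R]_n.+1 -> 'rV[R]_n.+1)
    (W : set 'rV[R]_n.+1) (K : R) : 0 <= K ->
  (forall c s, 0 < s ->
    (lebesgue_outer (G @` (box (cube c s) `&` W)) <= (K * s ^+ n.+1)%:E)%E) ->
  forall A, A `<=` W -> (lebesgue_outer A < +oo)%E ->
  (lebesgue_outer (G @` A) <= K%:E * lebesgue_outer A)%E.
Proof.
move=> K0 cubeK.
have K1 : 0 < K + 1 by rewrite ltr_wpDl.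
have boxK ab : (lebesgue_outer (G @` (box ab `&` W)) <= (K * box_volume ab)%:E)%E.
  have [[i hi]|hab] := pselect (exists i, ab.2 ord0 i <= ab.1 ord0 i).
    rewrite (empty_box hi) set0I image_set0 lebesgue_outer0 lee_fin.
    by rewrite mulr_ge0// box_volume_ge0.
  have {}hab i : ab.1 ord0 i < ab.2 ord0 i.
    by rewrite ltNge; apply/negP => h; apply: hab; exists i.
  pose l i := ab.2 ord0 i - ab.1 ord0 i.
  have l0 i : 0 < l i by rewrite subr_gt0.
  apply/lee_addgt0Pr => e e0.
  have [d d0 hd] := @prod_add_small R n l _ (divr_gt0 e0 K1).
  pose m i := (Num.truncn ((ab.2 ord0 i - ab.1 ord0 i) / d)).+1.
  pose M := (\max_i m i)%N.
  have sub := @box_subset_cubes ab d d0; rewrite -/m /= -/M in sub.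
  pose F := family (fun i => [pred j : 'I_M | (j < m i)%N]).
  pose X (f : {ffun 'I_n.+1 -> 'I_M}) :=
    G @` (box (cube (ab.1 + \row_i ((f i)%:R * d)) d) `&` W).
  have le1 : (lebesgue_outer (G @` (box ab `&` W)) <=
      \sum_(f | f \in F) lebesgue_outer (X f))%E.
    apply: le_trans (lebesgue_outer_fin _ _); apply: le_lebesgue_outer.
    move=> _ [x [/sub[f fF xf] Wx] <-]; exists f => //.
    by exists x.
  apply: (le_trans le1); apply: (le_trans (lee_sum _ _)).
    by move=> f _; exact: cubeK.
  rewrite sumEFin -EFinD lee_fin -mulr_sumr.
  have -> : \sum_(f in F) d ^+ n.+1 = \prod_i ((m i)%:R * d).
    transitivity (\sum_(f in F) \prod_(i < n.+1) d).
      by apply: eq_bigr => f _; rewrite prodr_const card_ord.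
    rewrite -(bigA_distr_big_dep _ (fun i j => d)); apply: eq_bigr => i _.
    rewrite -(big_ord_widen M (fun=> d)) ?sumr_const ?card_ord ?mulr_natl//.
    exact: leq_bigmax.
  have le2 : \prod_i ((m i)%:R * d) <= \prod_i l i + e / (K + 1).
    apply: le_trans (hd d (ltW d0) (lexx _)); apply: ler_prod => i _.
    rewrite mulr_ge0 ?(ltW d0)//= /m -natr1 mulrDl mul1r lerD2r -ler_pdivlMr//.
    by rewrite truncn_le divr_ge0 ?(ltW d0) ?(ltW (l0 i)).
  apply: (le_trans (ler_wpM2l K0 le2)).
  rewrite box_volumeE => [|i]; last exact: ltW.
  rewrite mulrDr lerD2l mulrCA ger_pMr// ler_pdivrMr// mul1r.
  by rewrite lerDl.
move=> A AW Aoo; apply/lee_addgt0Pr => e e0.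
have Afin : lebesgue_outer A \is a fin_num by rewrite ge0_fin_numE ?lebesgue_outer_ge0.
have [_ [B AB <-] hB] := lb_ereal_inf_adherent (divr_gt0 e0 K1) Afin.
apply: (@le_trans _ _ (lebesgue_outer (\bigcup_k (G @` (box (B k) `&` W))))).
  apply: le_lebesgue_outer => _ [x Ax <-]; have [k _ Bx] := AB _ Ax.
  by exists k => //; exists x => //; split => //; exact: AW.
apply: (le_trans (outer_measure_sigma_subadditive _ _)).
apply: (@le_trans _ _ (\sum_(k <oo) K%:E * (box_volume (B k))%:E)%E).
  apply: lee_nneseries => [k _ _|k _]; first exact: lebesgue_outer_ge0.
  by rewrite -EFinM; exact: boxK.
rewrite nneseriesZl//; last by move=> k _; rewrite lee_fin box_volume_ge0.
apply: (le_trans (lee_wpmul2l _ (ltW hB))); first by rewrite lee_fin.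
rewrite -/(lebesgue_outer A) -(fineK Afin) -!EFinD -!EFinM lee_fin mulrDr lerD2l.
by rewrite mulrCA ger_pMr// ler_pdivrMr// mul1r lerDl.
Qed.

End CubePrinciple.

(** * Measurability of open sets *)

Section Measurability.
Context {R : realType} {n : nat}.
Implicit Types (x c : 'rV[R]_n.+1) (A : set 'rV[R]_n.+1).

(** A half-space cuts a box into two boxes whose volumes add up. *)
Lemma halfspace_measurable (i : 'I_n.+1) (t : R) :
  measurable ([set x | x ord0 i <= t] : set (leb_rV R n)).
Proof.
apply: le_caratheodory_measurable => X.
apply: le_ereal_inf_tmp => _ [B XB <-].
pose B1 k : 'rV[R]_n.+1 * 'rV[R]_n.+1 := ((B k).1,
  \row_j if j == i then Num.min ((B k).2 ord0 j) t else (B k).2 ord0 j).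
pose B2 k : 'rV[R]_n.+1 * 'rV[R]_n.+1 :=
  (\row_j (if j == i then Num.max ((B k).1 ord0 j) t else (B k).1 ord0 j), (B k).2).
have vol k : box_volume (B1 k) + box_volume (B2 k) <= box_volume (B k).
  rewrite /box_volume (bigD1 i)//= [X in _ + X <= _](bigD1 i)//= [leRHS](bigD1 i)//=.
  rewrite !mxE eqxx.
  under eq_bigr => j ji do rewrite !mxE (negbTE ji).
  under [X in _ + _ * X <= _]eq_bigr => j ji do rewrite !mxE (negbTE ji).
  rewrite -mulrDl ler_wpM2r//.
    by apply: prodr_ge0 => j _; rewrite le_max lexx orbT.
  move: ((B k).1 ord0 i) ((B k).2 ord0 i) => a b.
  by rewrite /Num.max /Num.min; do ! case: ifPn; rewrite -?leNgt => *; lra.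
apply: (@le_trans _ _ (\sum_(k <oo) (box_volume (B1 k))%:E +
                       \sum_(k <oo) (box_volume (B2 k))%:E)%E).
  apply: leeD; apply: lebesgue_outer_le => x [/XB[k _ xk] /= xt]; exists k => //= j.
    have /andP[h1 h2] := xk j; rewrite /= mxE h1/=; case: eqP => [ji|//].
    by rewrite le_min h2 ji.
  have /andP[h1 h2] := xk j; rewrite /= mxE h2 andbT; case: eqP => [ji|//].
  by rewrite gt_max h1 ji ltNge; apply/negP.
rewrite -nneseriesD//; try by move=> k _ _; rewrite lee_fin box_volume_ge0.
apply: lee_nneseries => [k _ _|k _]; rewrite -EFinD lee_fin//.
by rewrite addr_ge0 ?box_volume_ge0.
Qed.

Lemma box_measurable ab : measurable (@box R n ab : set (leb_rV R n)).
Proof.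
have -> : box ab = \bigcap_(i in [set: 'I_n.+1])
    ([set x | x ord0 i <= ab.2 ord0 i] `\` [set x | x ord0 i <= ab.1 ord0 i]).
  apply/seteqP; split => [x h i _|x h i].
    by have /andP[h1 h2] := h i; split => //=; apply/negP; rewrite -ltNge.
  by have [//= -> /negP] := h i I; rewrite -ltNge => ->.
apply: fin_bigcap_measurable => //i _.
by apply: measurableD; exact: halfspace_measurable.
Qed.

(** Countably many boxes that form a base of neighbourhoods: local estimates
    are patched together along them. *)
Definition rat_box (k : nat) : 'rV[R]_n.+1 * 'rV[R]_n.+1 :=
  if @unpickle ('rV[rat]_n.+1 * 'rV[rat]_n.+1)%type k is Some pq
  then (map_mx ratr pq.1, map_mx ratr pq.2) else (0, 0).

Lemma nbhs_rat_box x (U : set 'rV[R]_n.+1) : nbhs x U ->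
  exists2 k, box (rat_box k) x & box (rat_box k) `<=` U.
Proof.
move=> /nbhs_ballP[e /= e0 eU]; have e20 : 0 < e / 2 by exact: divr_gt0.
have hp i : exists p : rat, x ord0 i - e / 2 < ratr p < x ord0 i.
  have [|p] := @rat_in_itvoo R (x ord0 i - e / 2) (x ord0 i); first by rewrite ltrBlDr ltrDl.
  by rewrite in_itv/=; exists p.
have hq i : exists q : rat, x ord0 i < ratr q < x ord0 i + e / 2.
  have [|q] := @rat_in_itvoo R (x ord0 i) (x ord0 i + e / 2); first by rewrite ltrDl.
  by rewrite in_itv/=; exists q.
have [p {}hp] := choice hp; have [q {}hq] := choice hq.
exists (pickle ((\row_i p i, \row_i q i) : 'rV[rat]_n.+1 * 'rV[rat]_n.+1)%type).
  rewrite /rat_box pickleK => i; rewrite /= !mxE.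
  by have /andP[_ ->] := hp i; have /andP[/ltW -> _] := hq i.
rewrite /rat_box pickleK => y yb; apply: eU.
rewrite -ball_normE /=; apply: (@le_lt_trans _ _ (e / 2)); last by lra.
apply: norm_le_coord; first exact: ltW.
move=> i; rewrite !mxE; have := yb i; rewrite /= !mxE => /andP[h1 h2].
have /andP[h3 h4] := hp i; have /andP[h5 h6] := hq i.
by rewrite ler_norml; apply/andP; split; lra.
Qed.

Lemma open_lebesgue_measurable (U : set 'rV[R]_n.+1) : open U ->
  measurable (U : set (leb_rV R n)).
Proof.
move=> oU.
have -> : U = \bigcup_(k in [set k | box (rat_box k) `<=` U]) box (rat_box k).
  apply/seteqP; split=> [x Ux|x [k /= h]]; last exact: h.
  by have [k kx kU] := nbhs_rat_box (open_nbhs_nbhs (conj oU Ux)); exists k.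
by apply: bigcup_measurable => k _; exact: box_measurable.
Qed.

End Measurability.

(** * Approximation by open boxes and the measure of a cube *)

Section Regularity.
Context {R : realType} {n : nat}.
Implicit Types (x c : 'rV[R]_n.+1) (A : set 'rV[R]_n.+1).

Lemma open_open_box ab : open (@open_box R n ab).
Proof.
rewrite openE => x xab.
suff : nbhs x [set y : 'rV[R]_n.+1 | forall i, ab.1 ord0 i < y ord0 i < ab.2 ord0 i] by [].
apply: (@filter_forall 'rV[R]_n.+1 'I_n.+1
  (fun i y => is_true (ab.1 ord0 i < y ord0 i < ab.2 ord0 i)) (nbhs x) _) => i.
have h : nbhs (x ord0 i) `]ab.1 ord0 i, ab.2 ord0 i[%classic.
  by apply: open_nbhs_nbhs; split; [exact: itv_open|rewrite /= in_itv; exact: xab].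
have {}h : nbhs x ((fun y : 'rV[R]_n.+1 => y ord0 i) @^-1` `]ab.1 ord0 i, ab.2 ord0 i[%classic).
  exact: (@coord_continuous _ _ _ ord0 i x _ h).
by apply: filterS h => y /=; rewrite in_itv.
Qed.

Lemma open_box_cover A (e : R) : 0 < e -> (lebesgue_outer A < +oo)%E ->
  exists B : nat -> 'rV[R]_n.+1 * 'rV[R]_n.+1,
    A `<=` \bigcup_k open_box (B k) /\
    (\sum_(k <oo) (box_volume (B k))%:E <= lebesgue_outer A + e%:E)%E.
Proof.
move=> e0 Aoo.
have Afin : lebesgue_outer A \is a fin_num by rewrite ge0_fin_numE ?lebesgue_outer_ge0.
have e20 : 0 < e / 2 by exact: divr_gt0.
have [_ [B AB <-] hB] := lb_ereal_inf_adherent e20 Afin.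
have hd k : exists d, 0 < d /\ box_volume ((B k).1, (B k).2 + const_mx d) <=
    box_volume (B k) + (e / 2) / (2 ^ k.+1)%:R.
  have ek : 0 < (e / 2) / (2 ^ k.+1)%:R by rewrite divr_gt0// ltr0n expn_gt0.
  have [d d0 hd] := @prod_add_small R n
    (fun i => Num.max ((B k).2 ord0 i - (B k).1 ord0 i) 0) _ ek.
  exists d; split => //; apply: le_trans (hd d (ltW d0) (lexx _)).
  apply: ler_prod => i _; rewrite !mxE le_max lexx orbT/= ge_max.
  by rewrite addrAC lerD2r le_max lexx/= addr_ge0 ?(ltW d0)// le_max lexx orbT.
have [d {}hd] := choice hd.
exists (fun k => ((B k).1, (B k).2 + const_mx (d k))); split.
  move=> x /AB[k _ xk]; exists k => // i; rewrite /= !mxE.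
  have /andP[-> h] := xk i; apply: (le_lt_trans h).
  by rewrite ltrDl; have [] := hd k.
apply: (@le_trans _ _ (\sum_(k <oo) ((box_volume (B k))%:E + ((e / 2) / (2 ^ k.+1)%:R)%:E))%E).
  apply: lee_nneseries => [k _ _|k _]; first by rewrite lee_fin box_volume_ge0.
  by rewrite lee_fin; have [] := hd k.
apply: (le_trans (epsilon_trick _ _ _)); last 1 first.
- apply: (le_trans (leeD2r _ (ltW hB))).
  by rewrite -/(lebesgue_outer A) -(fineK Afin) -!EFinD lee_fin; lra.
- by move=> k; rewrite lee_fin box_volume_ge0.
- exact: ltW.
Qed.

Lemma compact_bigcup_prefix (K : set 'rV[R]_n.+1) (U : nat -> set 'rV[R]_n.+1) :
  compact K -> (forall k, open (U k)) -> K `<=` \bigcup_k U k ->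
  exists m, forall x, K x -> exists2 k, (k < m)%N & U k x.
Proof.
move=> /compact_near_coveringP cK oU KU.
have := cK nat \oo (fun m x => exists2 k, (k < m)%N & U k x) _.
case.
  move=> x /KU[k _ Uk].
  exists (U k, [set m | (k < m)%N]) => /=.
    split; [exact: (open_nbhs_nbhs (conj (oU k) Uk))|exact: nbhs_infty_gt].
  by move=> [y m] /= [Uy km]; exists k.
move=> m _ /(_ m (leqnn _)) h; exists m => x Kx; exact: h.
Qed.

Lemma compact_closed_cube (c : 'rV[R]_n.+1) s :
  compact [set x : 'rV[R]_n.+1 | forall i, c ord0 i <= x ord0 i <= c ord0 i + s].
Proof.
have := @rV_compact R n.+1 (fun i => `[c ord0 i, c ord0 i + s]%classic)
  (fun i => @segment_compact R _ _).
by congr compact; apply/seteqP; split => x h i; have := h i; rewrite /= in_itv.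
Qed.

Lemma card_arith_prog (N : nat) (a b c h : R) : 0 < h ->
  #|[pred j : 'I_N | a < c + h * j%:R < b]|%:R <= Num.max (b - a) 0 / h + 1.
Proof.
move=> h0; set S := [pred j : 'I_N | _]; case: (pickP S) => [j0 j0S|S0]; last first.
  by rewrite eq_card0// addr_ge0// divr_ge0 ?(ltW h0)// le_max lexx orbT.
have ab : a < b by move: j0S => /andP[]; exact: lt_trans.
case: (@arg_minnP _ j0 S val j0S) => j jS jmin.
have hl : (#|S| <= (Num.truncn ((b - a) / h)).+1)%N.
  rewrite cardE -(size_map val) -(size_iota j (Num.truncn ((b - a) / h)).+1).
  apply: uniq_leq_size; first by rewrite map_inj_uniq ?enum_uniq//; exact: val_inj.
  move=> _ /mapP[i iS ->]; rewrite mem_enum in iS; rewrite mem_iota jmin//=.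
  rewrite addnS ltnS -leq_subLR.
  move: (jS) (iS); rewrite !inE => /andP[h1 h2] /andP[h3 h4].
  rewrite truncn_ge_nat ?divr_ge0 ?(ltW h0) ?subr_ge0 ?(ltW ab)//.
  by rewrite natrB ?jmin// ler_pdivlMr//; lra.
apply: (@le_trans _ _ (Num.truncn ((b - a) / h)).+1%:R); first by rewrite ler_nat.
rewrite -natr1 lerD2r; apply: (@le_trans _ _ ((b - a) / h)).
  by rewrite truncn_le divr_ge0 ?(ltW h0)// subr_ge0 ltW.
by rewrite ler_pM2r ?invr_gt0// le_max lexx.
Qed.

End Regularity.

Section CubeLowerBound.
Context {R : realType} {n : nat}.

Lemma prefix_lower_bound (d : nat -> R) m : (forall k, 0 < d k) ->
  exists2 e, 0 < e & forall k, (k < m)%N -> e <= d k.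
Proof.
move=> d0; elim: m => [|m [e e0 he]]; first by exists 1.
exists (Num.min e (d m)); first by rewrite lt_min e0 d0.
move=> k; rewrite ltnS leq_eqVlt => /predU1P[->|/he km].
  by rewrite ge_min lexx orbT.
by rewrite ge_min km.
Qed.

(** The lattice of step [s / N] has [N ^ n] points in the cube, and a box with
    sides [l i] contains at most [\prod_i (l i * N / s + 1)] of them: finitely
    many boxes covering the cube have total volume at least that of the cube.
    A countable cover reduces to a finite one by compactness. *)
Lemma lebesgue_outer_cube_ge (c : 'rV[R]_n.+1) (s : R) (A : set 'rV[R]_n.+1) :
  0 < s ->
  (forall x : 'rV[R]_n.+1,
    (forall i, c ord0 i <= x ord0 i <= c ord0 i + s) -> A x) ->
  ((s ^+ n.+1)%:E <= lebesgue_outer A)%E.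
Proof.
move=> s0 cA; have [->|] := eqVneq (lebesgue_outer A) +oo%E; first exact: leey.
rewrite -ltey => Aoo; apply/lee_addgt0Pr => e e0.
have e20 : 0 < e / 2 by exact: divr_gt0.
have [B [AB hB]] := open_box_cover e20 Aoo.
have [m hm] := compact_bigcup_prefix (@compact_closed_cube R n c s)
  (fun k => @open_open_box R n (B k)) (fun x cx => AB x (cA x cx)).
pose l k i := Num.max ((B k).2 ord0 i - (B k).1 ord0 i) 0.
have hd k : exists d, 0 < d /\ (forall t, 0 <= t -> t <= d ->
    \prod_i (l k i + t) <= box_volume (B k) + (e / 2) / (2 ^ k.+1)%:R).
  have ek : 0 < (e / 2) / (2 ^ k.+1)%:R by rewrite divr_gt0// ltr0n expn_gt0.
  by have [d d0 hd] := @prod_add_small R n (l k) _ ek; exists d.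
have [d {}hd] := choice hd.
have [d1 d10 hd1] := @prefix_lower_bound d m (fun k => (hd k).1).
(* the mesh [h] is fine enough for the boxes of the finite subcover *)
pose N := (Num.truncn (s / d1)).+1; pose h := s / N%:R.
have N0 : 0 < N%:R :> R by rewrite ltr0n.
have h0 : 0 < h by rewrite divr_gt0.
have hd1' : h <= d1.
  by rewrite ler_pdivrMr// mulrC -ler_pdivrMr//; exact/ltW/truncnS_gt.
pose Q k (i : 'I_n.+1) := [pred j : 'I_N |
  (B k).1 ord0 i < c ord0 i + h * j%:R < (B k).2 ord0 i].
have cov (f : {ffun 'I_n.+1 -> 'I_N}) : exists2 k : 'I_m, true & f \in family (Q k).
  have [|k km kf] := hm (c + \row_i (h * (f i)%:R)).
    move=> i; rewrite !mxE lerDl mulr_ge0 ?(ltW h0)//= lerD2l.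
    rewrite /h mulrAC ler_pdivrMr// ler_pM2l// ler_nat; exact: ltnW.
  exists (Ordinal km) => //; apply/familyP => i; rewrite inE /=.
  by have := kf i; rewrite !mxE.
have -> : s ^+ n.+1 = \sum_(f : {ffun 'I_n.+1 -> 'I_N}) h ^+ n.+1.
  rewrite sumr_const card_ffun !card_ord -mulr_natl natrX -exprMn.
  by rewrite /h mulrC divfK// gt_eqF.
have h1 : \sum_(f : {ffun 'I_n.+1 -> 'I_N}) h ^+ n.+1 <=
    \sum_(k < m) \prod_i (l k i + h).
  apply: (@le_trans _ _ (\sum_(f : {ffun 'I_n.+1 -> 'I_N})
      \sum_(k < m | f \in family (Q k)) h ^+ n.+1)).
    apply: ler_sum => f _; have [k _ kf] := cov f.
    rewrite (bigD1 k)//= lerDl; apply: sumr_ge0 => *; exact/exprn_ge0/ltW.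
  rewrite (exchange_big_dep xpredT)//=; apply: ler_sum => k _.
  rewrite (eq_bigr (fun=> \prod_(i < n.+1) h)); last first.
    by move=> f _; rewrite prodr_const card_ord.
  rewrite -(bigA_distr_big_dep _ (fun i j => h)); apply: ler_prod => i _.
  rewrite sumr_const mulrn_wge0 ?(ltW h0)//= -mulr_natl.
  have := @card_arith_prog R N ((B k).1 ord0 i) ((B k).2 ord0 i) (c ord0 i) h h0.
  move=> /(ler_wpM2r (ltW h0)) => /le_trans; apply.
  by rewrite mulrDl mul1r divfK// gt_eqF.
apply: (@le_trans _ _ (\sum_(0 <= k < m)
    ((box_volume (B k))%:E + ((e / 2) / (2 ^ k.+1)%:R)%:E))%E).
  rewrite -(big_mkord predT (fun k => \prod_i (l k i + h))) in h1.
  rewrite (eq_bigr (fun k => (box_volume (B k) + e / 2 / (2 ^ k.+1)%:R)%:E))// sumEFin lee_fin.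
  apply: (le_trans h1); rewrite !big_mkord; apply: ler_sum => k _.
  by apply: (hd k).2; [exact: ltW|apply: (le_trans hd1'); exact: hd1].
apply: (@le_trans _ _ (\sum_(k <oo) ((box_volume (B k))%:E + ((e / 2) / (2 ^ k.+1)%:R)%:E))%E).
  apply: nneseries_lim_ge => k _ _; rewrite lee_fin addr_ge0 ?box_volume_ge0//.
  by rewrite divr_ge0// ltW.
apply: (le_trans (epsilon_trick _ _ _)); last 1 first.
- apply: (le_trans (leeD2r _ hB)).
  have Afin : lebesgue_outer A \is a fin_num.
    by rewrite ge0_fin_numE ?lebesgue_outer_ge0.
  by rewrite -(fineK Afin) -!EFinD lee_fin; lra.
- by move=> k; rewrite lee_fin box_volume_ge0.
- exact: ltW.
Qed.

End CubeLowerBound.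

Section Dilations.
Context {R : realType} {n : nat}.

Lemma lebesgue_outer_dilate_le (d v : 'rV[R]_n.+1) (A : set 'rV[R]_n.+1) :
  (forall i, 0 < d ord0 i) -> (lebesgue_outer A < +oo)%E ->
  (lebesgue_outer ((fun x => \row_i (d ord0 i * x ord0 i + v ord0 i)%R) @` A) <=
   (\prod_i d ord0 i)%R%:E * lebesgue_outer A)%E.
Proof.
move=> d0; apply: (@image_measure_le_of_cubes R n _ setT) => //.
  by apply: prodr_ge0 => i _; exact: ltW.
move=> c s s0; rewrite setIT.
pose D : 'rV[R]_n.+1 * 'rV[R]_n.+1 := (\row_i (d ord0 i * c ord0 i + v ord0 i),
  \row_i (d ord0 i * (c ord0 i + s) + v ord0 i)).
apply: (@le_trans _ _ (lebesgue_outer (box D))).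
  apply: le_lebesgue_outer => _ [x xc <-] i; rewrite !mxE ltrD2r lerD2r.
  by rewrite ltr_pM2l// ler_pM2l//; have := xc i; rewrite !mxE.
apply: (le_trans (lebesgue_outer_box_le _)); rewrite lee_fin box_volumeE; last first.
  by move=> i; rewrite !mxE lerD2r ler_pM2l// lerDl ltW.
rewrite (eq_bigr (fun i => d ord0 i * s)) => [|i _]; last by rewrite !mxE; ring.
by rewrite big_split/= prodr_const card_ord.
Qed.

Lemma lebesgue_outer_bounded (A : set 'rV[R]_n.+1) :
  bounded_set A -> (lebesgue_outer A < +oo)%E.
Proof.
move=> [M [_ /(_ (M + 1))]]; rewrite ltrDl ltr01 => /(_ isT) AM.
pose D : 'rV[R]_n.+1 * 'rV[R]_n.+1 := (const_mx (- (M + 2)), const_mx (M + 1)).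
apply: (@le_lt_trans _ _ (lebesgue_outer (box D))).
  apply: le_lebesgue_outer => x /AM xM i; rewrite !mxE.
  have := le_trans (coord_le_norm x i) xM; rewrite ler_norml => /andP[h1 h2].
  by apply/andP; split; lra.
by apply: (le_lt_trans (lebesgue_outer_box_le _)); rewrite ltry.
Qed.

End Dilations.

(** * Images under linear maps *)

Section LinearImages.
Context {R : realType} {n : nat}.
Implicit Types (T S : 'M[R]_n.+1) (A : set 'rV[R]_n.+1).

(** Only sets of finite measure matter, which avoids the product of [0] and
    [+oo] when [K] vanishes. *)
Definition image_bound T (K : R) := forall A, (lebesgue_outer A < +oo)%E ->
  (lebesgue_outer ((mulmxr T : 'rV[R]_n.+1 -> 'rV[R]_n.+1) @` A) <=
   K%:E * lebesgue_outer A)%E.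

Lemma image_bound_mul S T K1 K2 : 0 <= K2 ->
  image_bound S K1 -> image_bound T K2 -> image_bound (S *m T) (K1 * K2).
Proof.
move=> K20 hS hT A Aoo; have h1 := hS A Aoo.
have -> : mulmxr (S *m T) @` A = mulmxr T @` (mulmxr S @` A).
  by rewrite image_comp; congr image; apply/funext => x /=; rewrite mulmxA.
apply: (le_trans (hT _ _)).
  apply: (le_lt_trans h1).
  have Afin : lebesgue_outer A \is a fin_num.
    by rewrite ge0_fin_numE ?lebesgue_outer_ge0.
  by rewrite -(fineK Afin) -EFinM ltry.
rewrite mulrC EFinM -muleA; apply: lee_wpmul2l => //.
Qed.

Lemma image_bound_diag (d : 'rV[R]_n.+1) : (forall i, 0 < d ord0 i) ->
  image_bound (diag_mx d) (\prod_i d ord0 i).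
Proof.
move=> d0 A Aoo; apply: le_trans (lebesgue_outer_dilate_le 0 d0 Aoo).
apply: le_lebesgue_outer => _ [x Ax <-]; exists x => //.
by apply/rowP => i; rewrite /= mul_mx_diag !mxE addr0 mulrC.
Qed.

Lemma image_bound_perm (s : {perm 'I_n.+1}) : image_bound (perm_mx s) 1.
Proof.
move=> A Aoo; apply: (@image_measure_le_of_cubes R n _ setT) => // c t t0; rewrite setIT mul1r.
apply: (@le_trans _ _ (lebesgue_outer (box (cube (col_perm s^-1%g c) t)))).
  apply: le_lebesgue_outer => _ [x xc <-] i.
  have -> : mulmxr (perm_mx s) x = col_perm s^-1%g x by rewrite col_permE invgK.
  by rewrite !mxE; have := xc (s^-1%g i); rewrite !mxE.
by rewrite -(cube_volume (col_perm s^-1%g c) (ltW t0)); exact: lebesgue_outer_box_le.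
Qed.

Lemma image_bound_near_diag T e : 0 < e ->
  (forall i j, i != j -> `|T i j| <= e) ->
  image_bound T (\prod_j (`|T j j| + n.+1%:R * e)).
Proof.
move=> e0 Te; pose r j := `|T j j| + n.+1%:R * e.
have r0 j : 0 < r j.
  have h : 0 < n.+1%:R * e by apply: mulr_gt0 => //; rewrite ltr0n.
  by rewrite /r; apply: ltr_wpDl h; exact: normr_ge0.
move=> A Aoo; apply: (@image_measure_le_of_cubes R n _ setT) => //.
  by apply: prodr_ge0 => i _; exact/ltW/r0.
move=> c s s0; rewrite setIT; pose z : 'rV[R]_n.+1 := c + const_mx (s / 2).
pose D : 'rV[R]_n.+1 * 'rV[R]_n.+1 :=
  (\row_j ((z *m T) ord0 j - s / 2 * r j), \row_j ((z *m T) ord0 j + s / 2 * r j)).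
apply: (@le_trans _ _ (lebesgue_outer (box D))).
  apply: le_lebesgue_outer => _ [x xc <-] j /=.
  have : `|((x - z) *m T) ord0 j| < s / 2 * r j.
    rewrite mxE; apply: (le_lt_trans (ler_norm_sum _ _ _)).
    apply: (@le_lt_trans _ _ (\sum_i (s / 2 * `|T i j|))).
      apply: ler_sum => i _; rewrite normrM ler_wpM2r// ler_norml !mxE.
      have := xc i; rewrite /= !mxE => /andP[h1 h2].
      by apply/andP; split; lra.
    rewrite -mulr_sumr ltr_pM2l ?divr_gt0// (bigD1 j)//= ltrD2l.
    apply: (@le_lt_trans _ _ (\sum_(i < n.+1 | i != j) e)).
      by apply: ler_sum => i ij; exact: Te.
    rewrite (eq_bigl (mem (predC1 j)))// sumr_const cardC1 card_ord.
    by rewrite -[X in X < _]mulr_natl ltr_pM2r// ltr_nat.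
  have -> : ((x - z) *m T) ord0 j = (x *m T) ord0 j - (z *m T) ord0 j.
    by rewrite mulmxBl mxE [X in _ + X]mxE.
  have -> : D.1 ord0 j = (z *m T) ord0 j - s / 2 * r j by rewrite mxE.
  have -> : D.2 ord0 j = (z *m T) ord0 j + s / 2 * r j by rewrite mxE.
  by rewrite ltr_norml => /andP[h1 h2]; apply/andP; split; lra.
apply: (le_trans (lebesgue_outer_box_le _)); rewrite lee_fin box_volumeE; last first.
  move=> j; rewrite [leLHS]mxE [leRHS]mxE lerBlDr -addrA lerDl.
  by rewrite addr_ge0// mulr_ge0 ?(ltW (r0 j))// divr_ge0// ltW.
rewrite (eq_bigr (fun j => r j * s)) => [|j _]; last by rewrite mxE [X in _ - X]mxE; lra.
by rewrite big_split/= prodr_const card_ord.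
Qed.

(** Conjugating a triangular matrix by [diag(lambda ^ w i)] with small
    [lambda] makes its off-diagonal entries as small as desired without
    changing the volume distortion, so only the diagonal counts. *)
Lemma image_bound_triangular T (w : 'I_n.+1 -> nat) :
  (forall i j, i != j -> T i j != 0 -> (w j < w i)%N) ->
  image_bound T (\prod_j `|T j j|).
Proof.
move=> Tw A Aoo; apply/lee_addgt0Pr => e' e'0.
have Afin : lebesgue_outer A \is a fin_num by rewrite ge0_fin_numE ?lebesgue_outer_ge0.
have a0 : 0 <= fine (lebesgue_outer A) by rewrite fine_ge0// lebesgue_outer_ge0.
pose e := e' / (fine (lebesgue_outer A) + 1).
have e0 : 0 < e by rewrite divr_gt0// ltr_wpDl.
have [d d0 hd] := @prod_add_small R n (fun j => `|T j j|) e e0.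
pose eps := d / n.+1%:R; have eps0 : 0 < eps by rewrite divr_gt0.
pose m := \sum_i \sum_j `|T i j|.
have m0 : 0 <= m by apply: sumr_ge0 => i _; exact: sumr_ge0.
have Tm i j : `|T i j| <= m.
  rewrite /m (bigD1 i)//= (bigD1 j)//= -addrA lerDl addr_ge0 ?sumr_ge0// => k _.
  exact: sumr_ge0.
pose lam := Num.min 1 (eps / (m + 1)).
have m1 : 0 < m + 1 by rewrite ltr_wpDl.
have lam0 : 0 < lam by rewrite lt_min ltr01/= divr_gt0.
have lam1 : lam <= 1 by rewrite ge_min lexx.
have lamm : lam * m <= eps.
  have : lam <= eps / (m + 1) by rewrite ge_min lexx orbT.
  rewrite ler_pdivlMr// mulrDr mulr1 => h; apply: le_trans h.
  by rewrite lerDl ltW.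
(* [D^-1] scales down what [D] scales up, so the two volume factors cancel *)
pose D : 'rV[R]_n.+1 := \row_i lam ^+ w i.
pose D' : 'rV[R]_n.+1 := \row_i (lam ^+ w i)^-1.
have D0 i : 0 < D ord0 i by rewrite mxE exprn_gt0.
have D'0 i : 0 < D' ord0 i by rewrite mxE invr_gt0 exprn_gt0.
pose T' : 'M[R]_n.+1 := \matrix_(i, j) (lam ^+ w i * T i j / lam ^+ w j).
have lamw k : lam ^+ k != 0 by rewrite expf_neq0// gt_eqF.
have TE : T = (diag_mx D' *m T') *m diag_mx D.
  apply/matrixP => i j; rewrite mul_mx_diag mxE mul_diag_mx !mxE.
  by rewrite mulrA mulrA mulVf// mul1r divfK.
have T'e i j : i != j -> `|T' i j| <= eps.
  move=> ij; rewrite mxE; have [->|Tij] := eqVneq (T i j) 0.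
    by rewrite mulr0 mul0r normr0 ltW.
  have wij := Tw i j ij Tij; rewrite mulrAC -expfB// normrM ger0_norm ?exprn_ge0 ?(ltW lam0)//.
  apply: le_trans lamm; apply: ler_pM => //; first by rewrite exprn_ge0// ltW.
  by rewrite -subnSK// exprS ler_piMr// ?(ltW lam0)// exprn_ile1// ltW.
have T'd j : T' j j = T j j by rewrite mxE mulrAC divff// mul1r.
have := image_bound_mul _ (image_bound_mul _ (image_bound_diag D'0)
  (image_bound_near_diag eps0 T'e)) (image_bound_diag D0).
rewrite -TE => /(_ _ _ A Aoo) h.
apply: (le_trans (h _ _)).
- by apply: prodr_ge0 => i _; exact: ltW.
- by apply: prodr_ge0 => i _; rewrite addr_ge0// mulr_ge0// ltW.
rewrite mulrAC -big_split/= big1 ?mul1r; last first.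
  by move=> i _; rewrite !mxE mulVf.
under eq_bigr => j _ do rewrite T'd.
rewrite -(fineK Afin) -!EFinM lee_fin.
apply: le_trans (ler_wpM2r a0 (hd _ _ _)) _.
- by rewrite mulr_ge0// ltW.
- by rewrite /eps mulrC divfK// pnatr_eq0.
rewrite mulrDl lerD2l /e -mulrA ger_pMr// mulrC ler_pdivrMr ?ltr_wpDl//.
by rewrite mul1r lerDl.
Qed.

Lemma image_bound_det T : image_bound T `|\det T|.
Proof.
have := cormen_lup_correct T; have := cormen_lup_perm T.
have := cormen_lup_detL T; have := @cormen_lup_lower _ _ T.
have := @cormen_lup_upper _ _ T.
case: (cormen_lup T) => [[P L] U] /= Uu Ll _ /is_perm_mxP[s ->] PT.
have TE : T = perm_mx s^-1 *m L *m U.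
  rewrite -mulmxA -[L *m U]PT mulmxA -perm_mxM mulVg perm_mx1.
  by rewrite mul1mx.
have detL : \prod_j `|L j j| = 1 by apply: big1 => j _; rewrite Ll// eqxx normr1.
have detT : `|\det T| = \prod_j `|U j j|.
  rewrite {1}TE !det_mulmx det_perm.
  have -> : \det L = 1.
    rewrite det_trig; first by apply: big1 => j _; rewrite Ll// eqxx.
    by apply/is_trig_mxP => i j ij; rewrite Ll ?(ltnW ij)// -val_eqE/= ltn_eqF.
  rewrite -(det_tr U) det_trig; last first.
    by apply/is_trig_mxP => i j ij; rewrite mxE Uu.
  rewrite mulr1 normrM normrX normrN1 expr1n mul1r normr_prod.
  by apply: eq_bigr => j _; rewrite mxE.
rewrite detT {1}TE -[X in image_bound _ X]mul1r.
apply: image_bound_mul; first exact: prodr_ge0.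
  rewrite -[X in image_bound _ X]mul1r; apply: image_bound_mul => //.
    exact: image_bound_perm.
  rewrite -detL; apply: (@image_bound_triangular _ val) => i j ij.
  apply: contraNT; rewrite -leqNgt => h; by rewrite Ll// (negbTE ij).
apply: (@image_bound_triangular _ (fun i => (n - i)%N)) => i j ij.
apply: contraNT; rewrite -leqNgt => h; rewrite Uu//.
have := ltn_ord i; have := ltn_ord j; move: ij h; rewrite -val_eqE /=; lia.
Qed.

End LinearImages.

Section ThickenedImages.
Context {R : realType} {n : nat}.

Lemma compact_thicken (K U : set 'rV[R]_n.+1) : compact K -> open U ->
  K `<=` U ->
  exists2 e : R, 0 < e & forall x y, K x -> `|y - x| <= e -> U y.
Proof.
move=> /compact_near_coveringP cK oU KU.
have := cK R 0^'+ (fun e x => forall y, `|y - x| <= e -> U y) _.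
case.
  move=> x Kx; have /nbhs_ballP[r /= r0 rU] := open_nbhs_nbhs (conj oU (KU x Kx)).
  have r20 : 0 < r / 2 by exact: divr_gt0.
  exists (ball x (r / 2), [set e | e < r / 2]) => /=.
    by split; [exact: nbhsx_ballx|exact: nbhs_right_lt].
  move=> [y e] /= [yx er] z zy; apply: rU.
  rewrite -ball_normE /=; rewrite -ball_normE /= in yx.
  apply: (le_lt_trans (ler_distD y _ _)); rewrite [r]splitr ltrD//.
  by rewrite distrC; exact: le_lt_trans er.
move=> r /= r0 h; exists (r / 2); first exact: divr_gt0.
move=> x y Kx; apply: (h (r / 2)) => //=; last exact: divr_gt0.
by rewrite sub0r normrN gtr0_norm ?divr_gt0// ltr_pdivrMr// ltr_pMr// ltr1n.
Qed.

Let unit_cube : set 'rV[R]_n.+1 := [set x | forall i, 0 <= x ord0 i <= 1].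

Lemma lebesgue_outer_unit_cube (e : R) : 0 < e ->
  (lebesgue_outer unit_cube <= (1 + e)%:E)%E.
Proof.
move=> e0; have [d d0 hd] := @prod_add_small R n (fun=> 1) e e0.
apply: (@le_trans _ _ (lebesgue_outer (@box R n (cube (const_mx (- d)) (1 + d))))).
  apply: le_lebesgue_outer => x hx i; rewrite !mxE addrCA addNr addr0.
  by have /andP[h ->] := hx i; rewrite (lt_le_trans _ h)// oppr_lt0.
apply: (le_trans (lebesgue_outer_box_le _)); rewrite lee_fin cube_volume; last first.
  by rewrite addr_ge0// ltW.
have := hd d (ltW d0) (lexx _).
by rewrite prodr_const card_ord [X in _ <= X + _]big1.
Qed.

(** Continuity of the measure along shrinking neighbourhoods of a compact
    set lets a map be compared with its linearisation, also when the linear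
    part [T] is singular. *)
Lemma lebesgue_outer_thickened_cube (T : 'M[R]_n.+1) (e : R) : 0 < e ->
  exists2 eta : R, 0 < eta & forall (c v : 'rV[R]_n.+1) (s : R)
      (S : set 'rV[R]_n.+1), 0 < s ->
    (forall y, S y -> exists2 x, box (cube c s) x &
       `|y - v - (x - c) *m T| <= eta * s) ->
    (lebesgue_outer S <= ((`|\det T| + e) * s ^+ n.+1)%:E)%E.
Proof.
move=> e0; pose Q := unit_cube.
pose f : 'rV[R]_n.+1 -> 'rV[R]_n.+1 := mulmxr T.
have cQ : compact Q.
  have := @compact_closed_cube R n 0 1; congr compact.
  by apply/seteqP; split => x h i; have := h i; rewrite mxE add0r.
have cf : continuous f.
  move=> x; apply/(@cvgrPdist_le _ _ _ (nbhs x) (nbhs_filter x)) => r r0.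
  pose m := \sum_i \sum_j `|T i j|.
  have m0 : 0 <= m by apply: sumr_ge0 => i _; exact: sumr_ge0.
  have m1 : 0 < m + 1 by rewrite ltr_wpDl.
  apply/nbhs_ballP; exists (r / (m + 1)) => /=; first exact: divr_gt0.
  move=> y; rewrite -ball_normE /= => xy; rewrite /f /= -mulmxBl.
  apply: norm_le_coord; first exact: ltW.
  move=> j; rewrite mxE; apply: (le_trans (ler_norm_sum _ _ _)).
  apply: (@le_trans _ _ (\sum_i r / (m + 1) * `|T i j|)).
    apply: ler_sum => i _; rewrite normrM ler_wpM2r//.
    exact: (le_trans (coord_le_norm _ _) (ltW xy)).
  rewrite -mulr_sumr mulrAC ler_pdivrMr// ler_pM2l//.
  apply: (@le_trans _ _ m); last by rewrite lerDl.
  by apply: ler_sum => i _; rewrite (bigD1 j)//= lerDl sumr_ge0.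
have cK : compact (f @` Q).
  by apply: continuous_compact => //; exact: continuous_subspaceT.
have Qoo : (lebesgue_outer Q < +oo)%E.
  by apply: (le_lt_trans (lebesgue_outer_unit_cube ltr01)); rewrite ltry.
pose e1 := e / 2 / (`|\det T| + 1).
have dT1 : 0 < `|\det T| + 1 by rewrite ltr_wpDl.
have e10 : 0 < e1 by rewrite !divr_gt0.
have Kle : (lebesgue_outer (f @` Q) <= (`|\det T| + e / 2)%:E)%E.
  apply: (le_trans (image_bound_det T Qoo)).
  apply: (le_trans (lee_wpmul2l _ (lebesgue_outer_unit_cube e10))) => //.
  rewrite -EFinM lee_fin mulrDr mulr1 lerD2l /e1 mulrCA ger_pMr ?divr_gt0//.
  by rewrite ler_pdivrMr// mul1r lerDl.
have Koo : (lebesgue_outer (f @` Q) < +oo)%E by rewrite (le_lt_trans Kle)// ltry.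
have e20 : 0 < e / 2 by exact: divr_gt0.
have [B [KB hB]] := open_box_cover e20 Koo.
pose U := \bigcup_k @open_box R n (B k).
have oU : open U by apply: bigcup_open => k _; exact: open_open_box.
have Ule : (lebesgue_outer U <= (`|\det T| + e)%:E)%E.
  apply: (@le_trans _ _ (\sum_(k <oo) (box_volume (B k))%:E)%E).
    apply: lebesgue_outer_le => x [k _ xk]; exists k => // i.
    by have /andP[-> /ltW ->] := xk i.
  apply: (le_trans hB); apply: (le_trans (leeD2r _ Kle)).
  by rewrite -EFinD lee_fin -addrA -splitr.
have Uoo : (lebesgue_outer U < +oo)%E by rewrite (le_lt_trans Ule)// ltry.
have [eta eta0 hU] := compact_thicken cK oU KB.
exists eta => // c v s S s0 hS.
apply: (@le_trans _ _ (lebesgue_outer ((fun x : 'rV[R]_n.+1 =>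
    \row_i ((const_mx s : 'rV[R]_n.+1) ord0 i * x ord0 i + v ord0 i)%R) @` U))).
  apply: le_lebesgue_outer => y /hS[x xc xy].
  exists (s^-1 *: (y - v)); last first.
    apply/rowP => i; rewrite !mxE mulrA divff ?gt_eqF// mul1r; lra.
  apply: (hU (f (s^-1 *: (x - c)))).
    exists (s^-1 *: (x - c)) => // i; rewrite !mxE.
    have := xc i; rewrite /= !mxE => /andP[h1 h2].
    rewrite mulrC divr_ge0 ?(ltW s0) ?subr_ge0 ?(ltW h1)//= ler_pdivrMr// mul1r.
    by rewrite lerBlDl.
  rewrite /f /= -scalemxAl -scalerBr normrZ ger0_norm ?invr_ge0 ?(ltW s0)//.
  by rewrite mulrC ler_pdivrMr.
apply: (le_trans (lebesgue_outer_dilate_le _ _ Uoo)) => [i|]; first by rewrite mxE.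
rewrite (eq_bigr (fun=> s)) => [|i _]; last by rewrite mxE.
rewrite prodr_const card_ord mulrC EFinM; apply: lee_wpmul2l => //.
by rewrite lee_fin exprn_ge0// ltW.
Qed.

End ThickenedImages.

(** * Strict differentiability and second derivatives *)

Section StrictDifferentiability.
Context {R : realType} {n : nat}.
Implicit Types (g u : 'rV[R]_n -> R) (V : set 'rV[R]_n) (x y v : 'rV[R]_n).

Lemma is_derive_line g x v (t : R) : derivable g (x + t *: v) v ->
  is_derive t 1 (fun s => g (x + s *: v)) ('D_v g (x + t *: v)).
Proof.
have E : (fun h : R => h^-1 *: (g (x + (h *: 1 + t) *: v) - g (x + t *: v))) =
         (fun h : R => h^-1 *: (g (h *: v + (x + t *: v)) - g (x + t *: v))).
  apply/funext => h; congr (_ *: (g _ - _)).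
  by rewrite [h *: 1]mulr1 scalerDl addrCA.
by move=> gd; apply: DeriveDef; rewrite /derivable /derive /= E.
Qed.

Lemma mvt_open (f df : R -> R) (a b : R) : a < b ->
  (forall t, a <= t <= b -> is_derive t 1 f (df t)) ->
  exists2 c, a < c < b & f b - f a = df c * (b - a).
Proof.
move=> ab fd; have [|| c] := @MVT R f df a b ab.
- by move=> t; rewrite in_itv/= => /andP[h1 h2]; apply: fd; rewrite !ltW.
- apply: derivable_within_continuous => t; rewrite in_itv/= => h.
  exact: (@ex_derive _ _ _ _ _ _ _ (fd t h)).
by rewrite in_itv/= => h E; exists c.
Qed.

Lemma mvt_affine_bound (f df : R -> R) (l e a b : R) :
  (forall t, Num.min a b <= t <= Num.max a b ->
     is_derive t 1 f (df t) /\ `|df t - l| <= e) ->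
  `|f b - f a - l * (b - a)| <= e * `|b - a|.
Proof.
wlog ab : a b / a < b => [hw fd|].
  have [ab|ba|->] := ltgtP a b; first exact: hw.
    have -> : f b - f a - l * (b - a) = - (f a - f b - l * (a - b)) by ring.
    by rewrite normrN (distrC b a); apply: hw => //; rewrite minC maxC.
  by rewrite !subrr mulr0 subr0 normr0 mulr0.
rewrite (min_idPl (ltW ab)) (max_idPr (ltW ab)) => fd.
have [c /andP[ac cb] ->] := mvt_open ab (fun t h => (fd t h).1).
rewrite -mulrBl normrM ler_wpM2r//.
by apply: (fd c _).2; rewrite !ltW.
Qed.

(** The segment from [y] to [x] is replaced by a path that changes one
    coordinate at a time, and the mean value theorem is applied on each of its
    pieces; sup-norm balls contain such paths. *)
Lemma strict_diff g V x0 (e : R) : Ck_on 1 V g -> open V -> V x0 -> 0 < e ->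
  exists2 r, 0 < r & ball x0 r `<=` V /\ forall x y, ball x0 r x -> ball x0 r y ->
    `|g x - g y - \sum_i (x - y) ord0 i * partial i g x0| <= e * `|x - y|.
Proof.
move=> [_ gC] oV Vx0 e0.
pose e1 := e / (n%:R + 1).
have n1 : 0 < n%:R + 1 :> R by rewrite ltr_wpDl.
have e10 : 0 < e1 by exact: divr_gt0.
have : \forall x \near x0, V x /\ forall i, `|partial i g x0 - partial i g x| <= e1.
  apply: filterI; first exact: (open_nbhs_nbhs (conj oV Vx0)).
  apply: (@filter_forall _ _ (fun i x =>
    is_true (`|partial i g x0 - partial i g x| <= e1)) (nbhs x0) _) => i.
  have [_ [/(_ _ Vx0) ci _]] := gC i.
  by move/(@cvgrPdist_le _ _ _ (nbhs x0) (nbhs_filter x0)) : ci => /(_ e1 e10).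
move=> /nbhs_ballP[r /= r0 hr]; exists r => //; split; first by move=> x /hr[].
move=> x y xr yr; pose z (k : nat) : 'rV[R]_n := \row_i if (i < k)%N then x ord0 i else y ord0 i.
have z0 : z 0%N = y by apply/rowP => i; rewrite mxE.
have zn : z n = x by apply/rowP => i; rewrite mxE ltn_ord.
have zS (k : 'I_n) : z k.+1 = z k + (x - y) ord0 k *: delta_mx ord0 k.
  apply/rowP => i; rewrite !mxE eqxx/= ltnS.
  have [ik|ik|/val_inj ik] := ltngtP i k.
  - by rewrite -val_eqE /= (ltn_eqF ik) mulr0 addr0.
  - by rewrite -val_eqE /= (gtn_eqF ik) mulr0 addr0.
  by rewrite ik eqxx mulr1 addrC subrK.
have zr (k : 'I_n) t : Num.min 0 ((x - y) ord0 k) <= t <= Num.max 0 ((x - y) ord0 k) ->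
    ball x0 r (z k + t *: delta_mx ord0 k).
  move=> ht; move: xr yr; rewrite -ball_normE /= => xr yr.
  have [m mr hm] : exists2 m, m < r & `|x0 - x| <= m /\ `|x0 - y| <= m.
    exists (Num.max `|x0 - x| `|x0 - y|); first by rewrite gt_max xr yr.
    by rewrite !le_max !lexx orbT.
  apply: le_lt_trans mr; have m0 : 0 <= m by apply: le_trans hm.1.
  apply: norm_le_coord => // i; rewrite !mxE eqxx /=.
  have := le_trans (coord_le_norm _ i) hm.1; have := le_trans (coord_le_norm _ i) hm.2.
  rewrite !mxE; have [ik|ik|/val_inj ik] := ltngtP i k.
  - by rewrite -val_eqE /= (ltn_eqF ik) mulr0 addr0.
  - by rewrite -val_eqE /= (gtn_eqF ik) mulr0 addr0.
  rewrite -ik eqxx mulr1; move: ht; rewrite -ik !mxE.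
  rewrite !ler_norml /Num.min /Num.max => + /andP[h1 h2] /andP[h3 h4].
  by case: ifPn => h /andP[h5 h6]; apply/andP; split; lra.
(* telescope along the path from [y = z 0] to [x = z n] *)
rewrite -{1}zn -{1}z0 -(telescope_sumr (fun k => g (z k)) (leq0n n)) big_mkord -sumrB.
apply: (le_trans (ler_norm_sum _ _ _)).
apply: (@le_trans _ _ (\sum_(k < n) e1 * `|x - y|)); last first.
  rewrite -mulr_suml ler_wpM2r// sumr_const card_ord -mulr_natr /e1 mulrAC.
  by rewrite ler_pdivrMr// ler_pM2l// lerDl.
apply: ler_sum => k _; apply: (@le_trans _ _ (e1 * `|(x - y) ord0 k|)); last first.
  by rewrite ler_pM2l//; exact: coord_le_norm.
have := @mvt_affine_bound (fun t => g (z k + t *: delta_mx ord0 k))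
   (fun t => partial k g (z k + t *: delta_mx ord0 k)) (partial k g x0) e1 0
   ((x - y) ord0 k).
rewrite subr0 -zS scale0r addr0 mulrC; apply => t /zr/hr[Vz hz]; split.
  by apply: is_derive_line; have [h _] := gC k; exact: h.
by rewrite distrC.
Qed.

End StrictDifferentiability.

Section SecondOrder.
Context {R : realType} {n : nat}.
Implicit Types (g u : 'rV[R]_n -> R) (V Omega : set 'rV[R]_n) (x y v : 'rV[R]_n).

(** The chain rule along a line, for a direction that need not be a
    coordinate direction. *)
Lemma C1_derive_line g V x v (t : R) : Ck_on 1 V g -> open V -> V (x + t *: v) ->
  is_derive t 1 (fun s => g (x + s *: v))
    (\sum_i v ord0 i * partial i g (x + t *: v)).
Proof.
move=> gC oV Vx; set x1 := x + t *: v in Vx *; set L := \sum_i _.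
have H : h^-1 *: (g (x + (h *: 1 + t) *: v) - g x1) @[h --> (0 : R)^'] --> L.
  apply/cvgrPdist_le => e e0.
  have v1 : 0 < `|v| + 1 by rewrite ltr_wpDl.
  have [r r0 [rV hr]] := strict_diff gC oV Vx (divr_gt0 e0 v1).
  have rv0 : 0 < r / (`|v| + 1) by exact: divr_gt0.
  near=> h.
  have h0 : h != 0 by near: h; exact: nbhs_dnbhs_neq.
  have hh0 : 0 < `|h| by rewrite normr_gt0.
  have hr1 : `|h| * `|v| < r.
    apply: (@le_lt_trans _ _ (`|h| * (`|v| + 1))); first by rewrite ler_pM2l// lerDl.
    rewrite -ltr_pdivlMr//; near: h; exact: dnbhs0_lt.
  have -> : x + (h *: 1 + t) *: v = h *: v + x1.
    by rewrite /x1 [h *: 1]mulr1 scalerDl addrCA.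
  have := hr (h *: v + x1) x1; rewrite -!ball_normE /= subrr normr0 opprD addrCA subrr.
  rewrite addr0 normrN normrZ => /(_ hr1 r0); rewrite addrK.
  have -> : \sum_i (h *: v) ord0 i * partial i g x1 = h * L.
    by rewrite mulr_sumr; apply: eq_bigr => i _; rewrite mxE mulrA.
  move=> E; rewrite -(ler_pM2l hh0) -normrM mulrBr.
  have -> : h * (h^-1 *: (g (h *: v + x1) - g x1)) = g (h *: v + x1) - g x1.
    by rewrite -[_ *: _]/(h^-1 * (g (h *: v + x1) - g x1)) mulrA mulfV// mul1r.
  rewrite distrC; apply: (le_trans E); rewrite normrZ mulrCA ler_pM2l//.
  by rewrite mulrAC ler_pdivrMr// ler_pM2l// lerDl.
by apply: DeriveDef; [exact: cvgP H|exact: cvg_lim H].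
Unshelve. all: by end_near. Qed.

Lemma Ck_on_partial k V g i : Ck_on k.+1 V g -> Ck_on k V (partial i g).
Proof. by move=> [_ /(_ i)[]]. Qed.

Lemma Ck_on_S k V g : Ck_on k.+1 V g -> Ck_on k V g.
Proof.
elim: k g => [g []//|k ih g [gc gS]]; split => // i.
by have [gd gk] := gS i; split => //; exact: ih.
Qed.

Lemma double_difference_bound u V x0 (e : R) (i j : 'I_n) : Ck_on 2 V u ->
  open V -> V x0 -> 0 < e -> exists2 d, 0 < d & forall s, 0 < s -> s <= d ->
  `|u (x0 + s *: delta_mx ord0 i + s *: delta_mx ord0 j)
    - u (x0 + s *: delta_mx ord0 i) - u (x0 + s *: delta_mx ord0 j) + u x0
    - s ^+ 2 * partial j (partial i u) x0| <= e * s ^+ 2.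
Proof.
move=> uC oV Vx0 e0.
have [r r0 [rV hr]] := strict_diff (Ck_on_partial i uC) oV Vx0 e0.
exists (r / 3); first exact: divr_gt0.
move=> s s0 sr.
have delta_le (k : 'I_n) : `|delta_mx ord0 k : 'rV[R]_n| <= 1.
  apply: norm_le_coord => // l; rewrite mxE eqxx /=.
  by case: eqP; rewrite ?normr1 ?normr0.
have inr t t' : 0 <= t <= s -> 0 <= t' <= s ->
    ball x0 r (x0 + t *: delta_mx ord0 i + t' *: delta_mx ord0 j).
  move=> /andP[t0 ts] /andP[t'0 t's].
  rewrite -ball_normE /= -addrA opprD addrA subrr add0r normrN.
  apply: (le_lt_trans (ler_normD _ _)); rewrite !normrZ !ger0_norm//.
  apply: (@le_lt_trans _ _ (s + s)); last by lra.
  by apply: lerD; rewrite -[leRHS]mulr1 ler_pM.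
have inr0 t : 0 <= t <= s -> ball x0 r (x0 + t *: delta_mx ord0 i).
  by move=> ts; have := @inr t 0 ts; rewrite scale0r addr0; apply; rewrite lexx ltW.
have ud x : ball x0 r x -> derivable u x (delta_mx ord0 i).
  by move=> /rV Vx; have [_ /(_ i)[h _]] := uC; exact: h.
pose phi t := u (x0 + s *: delta_mx ord0 j + t *: delta_mx ord0 i) -
              u (x0 + t *: delta_mx ord0 i).
pose dphi t := partial i u (x0 + s *: delta_mx ord0 j + t *: delta_mx ord0 i) -
               partial i u (x0 + t *: delta_mx ord0 i).
have := @mvt_affine_bound R phi dphi (s * partial j (partial i u) x0) (e * s) 0 s.
have -> : phi s - phi 0 - s * partial j (partial i u) x0 * (s - 0) =
  u (x0 + s *: delta_mx ord0 i + s *: delta_mx ord0 j)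
    - u (x0 + s *: delta_mx ord0 i) - u (x0 + s *: delta_mx ord0 j) + u x0
    - s ^+ 2 * partial j (partial i u) x0.
  by rewrite /phi scale0r !addr0 [x0 + _ + _]addrAC; ring.
have -> : e * s * `|s - 0| = e * s ^+ 2 by rewrite subr0 ger0_norm ?(ltW s0)//; ring.
apply => t.
rewrite (min_idPl (ltW s0)) (max_idPr (ltW s0)) => ht.
have in1 : ball x0 r (x0 + s *: delta_mx ord0 j + t *: delta_mx ord0 i).
  by rewrite addrAC; apply: inr => //; rewrite lexx ltW.
have in2 := inr0 t ht.
split; first by apply: is_deriveB; apply: is_derive_line; exact: ud.
have := hr _ _ in1 in2; have -> : x0 + s *: delta_mx ord0 j + t *: delta_mx ord0 i -
    (x0 + t *: delta_mx ord0 i) = s *: delta_mx ord0 j.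
  by rewrite [x0 + _ + _]addrAC [X in X - _]addrC addrK.
rewrite (bigD1 j)//= big1 ?addr0; last first.
  by move=> k kj; rewrite !mxE eqxx/= (negbTE kj) mulr0 mul0r.
rewrite !mxE !eqxx mulr1 => h; apply: (le_trans h).
by rewrite normrZ ger0_norm ?(ltW s0)// ler_pM2l// ler_piMr// ltW.
Qed.

(** Clairaut: both mixed derivatives are limits of the same double difference
    quotient. *)
Lemma partial_comm u V x0 i j : Ck_on 2 V u -> open V -> V x0 ->
  partial i (partial j u) x0 = partial j (partial i u) x0.
Proof.
move=> uC oV Vx0; apply/eqP; rewrite -subr_eq0 -normr_le0.
apply/ler_addgt0Pr => e e0; rewrite add0r.
have e20 : 0 < e / 2 by exact: divr_gt0.
have [d1 d10 h1] := double_difference_bound i j uC oV Vx0 e20.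
have [d2 d20 h2] := double_difference_bound j i uC oV Vx0 e20.
(* one step for both estimates: the double difference is symmetric *)
pose s := Num.min d1 d2; have s0 : 0 < s by rewrite lt_min d10.
have := h1 s s0; rewrite ge_min lexx => /(_ isT).
have := h2 s s0; rewrite ge_min lexx orbT => /(_ isT).
rewrite [x0 + _ + _]addrAC; move: (u _) (u _) (u _) (u _) => A B C D.
move: (partial _ _ _) (partial _ _ _) => p q.
have s20 : 0 < s ^+ 2 by rewrite exprn_gt0.
move: (s ^+ 2) s20 => w w0.
rewrite !ler_norml => /andP[k1 k2] /andP[k3 k4].
by apply/andP; split; rewrite -(ler_pM2l w0); lra.
Qed.

(** First order expansion in the two directions [e_i] and [- e_i]: the plane
    stays above [u] on both sides of [y]. *)
Lemma contact_gradient V Omega u y p : Ck_on 1 V u -> open V -> V `<=` Omega ->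
  V y -> (forall x, Omega x -> u x <= u y + dotv p (x - y)) ->
  forall i, partial i u y = p ord0 i.
Proof.
move=> uC oV VO Vy hy i; apply/eqP; rewrite -subr_eq0 -normr_le0.
apply/ler_addgt0Pr => e e0; rewrite add0r.
have [r r0 [rV hr]] := strict_diff uC oV Vy e0.
pose t := r / 2; have t0 : 0 < t by exact: divr_gt0.
have dn : `|delta_mx ord0 i : 'rV[R]_n| <= 1.
  apply: norm_le_coord => // l; rewrite mxE eqxx /=.
  by case: eqP; rewrite ?normr1 ?normr0.
have key (s : R) : `|s| = t -> s * (partial i u y - p ord0 i) <= e * t.
  move=> st.
  have inb : ball y r (y + s *: delta_mx ord0 i).
    rewrite -ball_normE /= opprD addrA subrr add0r normrN normrZ st.
    by apply: (@le_lt_trans _ _ t); [rewrite ler_piMr// ltW|rewrite /t; lra].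
  have yE : y + s *: delta_mx ord0 i - y = s *: delta_mx ord0 i :> 'rV[R]_n.
    by rewrite addrAC subrr add0r.
  have := hr _ _ inb (ballxx y r0); rewrite yE normrZ st.
  rewrite (bigD1 i)//= big1 ?addr0; last first.
    by move=> k ki; rewrite !mxE eqxx/= (negbTE ki) mulr0 mul0r.
  rewrite !mxE !eqxx mulr1 => h.
  have := hy _ (VO _ (rV _ inb)); rewrite yE /dotv (bigD1 i)//= big1 ?addr0; last first.
    by move=> k ki; rewrite !mxE eqxx/= (negbTE ki) !mulr0.
  rewrite !mxE !eqxx mulr1 => h2.
  have h3 : e * (t * `|delta_mx ord0 i : 'rV[R]_n|) <= e * t.
    by rewrite ler_pM2l// ler_piMr// ltW.
  move: (le_trans h h3); rewrite ler_norml => /andP[h4 h5]; lra.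
have k1 := key t (ger0_norm (ltW t0)).
have k2 : - t * (partial i u y - p ord0 i) <= e * t.
  by apply: key; rewrite normrN ger0_norm// ltW.
rewrite -(ler_pM2l t0) -[t in leLHS]ger0_norm ?(ltW t0)// -normrM ler_norml.
by apply/andP; split; lra.
Qed.

(** Along the line through [y] of direction [v], the mean value theorem gives a
    point close to [y], on the side of [v], at which the slope of [u] is at most
    its slope at [y]; a positive second derivative excludes that. *)
Lemma contact_hessian V Omega u y p v : Ck_on 2 V u -> open V -> V `<=` Omega ->
  V y -> (forall x, Omega x -> u x <= u y + dotv p (x - y)) ->
  \sum_i \sum_j v ord0 i * v ord0 j * partial j (partial i u) y <= 0.
Proof.
move=> uC oV VO Vy hy; set Q := \sum_i _.
have gradE := contact_gradient (Ck_on_S uC) oV VO Vy hy.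
pose K := `|v| * \sum_i `|v ord0 i|.
have K0 : 0 <= K by rewrite mulr_ge0// sumr_ge0.
apply/ler_addgt0Pr => e' e'0; rewrite add0r.
pose e := e' / (K + 1); have K1 : 0 < K + 1 by rewrite ltr_wpDl.
have e0 : 0 < e by exact: divr_gt0.
have hi (i : 'I_n) : exists d, 0 < d /\ (ball y d `<=` V /\
    forall x, ball y d x -> `|partial i u x - partial i u y -
      \sum_j (x - y) ord0 j * partial j (partial i u) y| <= e * `|x - y|).
  have [d d0 [dV hd]] := strict_diff (Ck_on_partial i uC) oV Vy e0.
  by exists d; split => //; split => // x xd; apply: hd => //; exact: ballxx.
have [d hd] := choice hi.
have [/= r0 r0V hr0] : exists2 r, 0 < r & ball y r `<=` V.
  by have /nbhs_ballP[r /= r0 rV] := open_nbhs_nbhs (conj oV Vy); exists r.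
pose r := \big[Num.min/r0]_i d i.
have rgt0 : 0 < r by apply: lt_bigmin => // i _; have [] := hd i.
have rd i : r <= d i by exact: bigmin_le_cond.
have rr0 : r <= r0 by exact: bigmin_le_id.
have v1 : 0 < `|v| + 1 by rewrite ltr_wpDl.
pose t := r / (`|v| + 1) / 2; have t0 : 0 < t by rewrite !divr_gt0.
have inb s : 0 <= s <= t -> ball y r (y + s *: v).
  move=> /andP[s0 st]; rewrite -ball_normE /= opprD addrA subrr add0r normrN normrZ ger0_norm//.
  apply: (@le_lt_trans _ _ (t * (`|v| + 1))).
    by apply: ler_pM => //; rewrite lerDl.
  by rewrite /t mulrAC divfK ?gt_eqF//; lra.
have [|c /andP[c0 ct] E] := @mvt_open R (fun s => u (y + s *: v))
    (fun s => \sum_i v ord0 i * partial i u (y + s *: v)) 0 t t0.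
  move=> s hs; apply: (C1_derive_line (V := V)) => //; first exact: Ck_on_S.
  apply: hr0; apply: le_ball rr0 _ _; exact: inb.
have hc : 0 <= c <= t by rewrite !ltW.
have h0 : 0 <= t <= t by rewrite lexx ltW.
have yvE s : y + s *: v - y = s *: v by rewrite addrAC subrr add0r.
have := hy _ (VO _ (hr0 _ (le_ball rr0 (inb t h0)))).
rewrite yvE => hyt.
rewrite scale0r addr0 subr0 in E.
have D1 : dotv p (t *: v) = t * \sum_i v ord0 i * partial i u y.
  by rewrite /dotv mulr_sumr; apply: eq_bigr => i _; rewrite mxE gradE; ring.
have h1 : \sum_i v ord0 i * (partial i u (y + c *: v) - partial i u y) <= 0.
  rewrite -(pmulr_rle0 _ t0); under eq_bigr do rewrite mulrBr.
  by rewrite sumrB mulrBr -D1 mulrC -E; lra.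
have h2 : c * Q - c * (e * K) <=
    \sum_i v ord0 i * (partial i u (y + c *: v) - partial i u y).
  rewrite /Q /K !mulr_sumr -sumrB; apply: ler_sum => i _.
  have := (hd i).2.2 _ (le_ball (rd i) (inb c hc)).
  rewrite yvE normrZ gtr0_norm//.
  have -> : \sum_j (c *: v) ord0 j * partial j (partial i u) y =
    c * \sum_j v ord0 j * partial j (partial i u) y.
    by rewrite mulr_sumr; apply: eq_bigr => j _; rewrite mxE mulrA.
  have -> : \sum_j v ord0 i * v ord0 j * partial j (partial i u) y =
    v ord0 i * \sum_j v ord0 j * partial j (partial i u) y.
    by rewrite mulr_sumr; apply: eq_bigr => j _; rewrite mulrA.
  set a := partial i u _ - _; set b := \sum_j _ => hab.
  have : `|v ord0 i * (a - c * b)| <= `|v ord0 i| * (e * (c * `|v|)).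
    by rewrite normrM ler_wpM2l.
  by rewrite ler_norml => /andP[h3 h4]; lra.
have h3 : Q <= e * K.
  by rewrite -(ler_pM2l c0); lra.
apply: (le_trans h3); rewrite /e mulrAC ler_pdivrMr// ler_pM2l// lerDl//.
Qed.

End SecondOrder.

(** * Determinants of positive matrices *)

Section PositiveMatrices.
Context {R : rcfType}.

Definition quad {n} (A : 'M[R]_n) (x : 'rV[R]_n) : R := (x *m A *m x^T) ord0 ord0.

Lemma quadE n (A : 'M[R]_n) x :
  quad A x = \sum_i \sum_j A i j * x ord0 i * x ord0 j.
Proof.
rewrite /quad mxE (eq_bigr (fun j => \sum_i A i j * x ord0 i * x ord0 j)).
  by rewrite exchange_big.
by move=> j _; rewrite !mxE mulr_suml; apply: eq_bigr => i _; ring.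
Qed.

(** Cholesky, in the semidefinite case: when the pivot [a] vanishes so does its
    row [v], and with [0^-1 = 0] the usual formulas remain correct. *)
Lemma psd_factor n (A : 'M[R]_n) : A^T = A -> (forall x, 0 <= quad A x) ->
  exists D : 'M[R]_n, A = D *m D^T.
Proof.
elim: n A => [A _ _|n ih]; first by exists 0; rewrite [A]flatmx0 mul0mx.
rewrite -[n.+1]/(1 + n)%N => A AT Apos.
pose a := A ord0 ord0; pose v := ursubmx A; pose A' := drsubmx A.
have AE : A = block_mx a%:M v v^T A'.
  rewrite -[LHS]submxK /v trmx_ursub AT; congr block_mx.
  by rewrite [ulsubmx A]mx11_scalar; congr _%:M; rewrite !mxE; congr (A _ _); exact: val_inj.
have A'T : A'^T = A' by rewrite /A' trmx_drsub AT.
pose vy (y : 'rV[R]_n) := (y *m v^T) ord0 ord0.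
have yvE y : y *m v^T = (vy y)%:M by rewrite [LHS]mx11_scalar.
have vyE y : v *m y^T = (vy y)%:M.
  by rewrite -[v]trmxK -trmx_mul yvE tr_scalar_mx.
have q t (y : 'rV[R]_n) : quad A (row_mx t%:M y) = a * t ^+ 2 + 2 * t * vy y + quad A' y.
  rewrite /quad {1}AE mul_row_block tr_row_mx mul_row_col tr_scalar_mx yvE.
  rewrite [X in _ + X]mulmxDl -(mulmxA t%:M v) vyE -!scalar_mxM.
  rewrite -[X in X *m _]raddfD -scalar_mxM addrA -[X in X + _]raddfD.
  by rewrite mxE [X in X + _]mxE eqxx mulr1n; congr (_ + _); ring.
have a0 : 0 <= a.
  have := Apos (row_mx 1%:M 0); rewrite q expr1n mulr1 /vy mul0mx mxE mulr0 addr0.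
  by rewrite /quad mul0mx mul0mx mxE addr0.
have v0 : a = 0 -> v = 0.
  move=> a00.
  have vv0 : vy v <= 0.
    rewrite leNgt; apply/negP => vv.
    have := Apos (row_mx (- (quad A' v + 1) / (2 * vy v))%:M v).
    rewrite q a00 mul0r add0r.
    have -> : 2 * (- (quad A' v + 1) / (2 * vy v)) * vy v = - (quad A' v + 1).
      by field; rewrite gt_eqF.
    lra.
  have : \sum_i v ord0 i ^+ 2 = 0.
    apply/eqP; rewrite eq_le sumr_ge0 ?andbT => [|i _]; last exact: sqr_ge0.
    apply: le_trans vv0; rewrite /vy mxE; apply: ler_sum => i _.
    by rewrite [v^T _ _]mxE expr2.
  move=> /eqP; rewrite psumr_eq0 => [/allP h|i _]; last exact: sqr_ge0.
  apply/rowP => i; rewrite [RHS]mxE; apply/eqP; rewrite -sqrf_eq0.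
  by apply: h; rewrite mem_index_enum.
have [|x|D' D'E] := ih (A' - a^-1 *: (v^T *m v)).
- by rewrite raddfB /= A'T linearZ /= trmx_mul trmxK.
- have := Apos (row_mx (- (a^-1 * vy x))%:M x); rewrite q.
  have -> : quad (A' - a^-1 *: (v^T *m v)) x = quad A' x - a^-1 * vy x ^+ 2.
    rewrite {1}/quad mulmxBr mulmxBl -scalemxAr -scalemxAl !mulmxA yvE -(mulmxA _ v) vyE.
    by rewrite -scalar_mxM mxE [X in _ + X]mxE [X in _ - X]mxE [X in _ * X]mxE eqxx mulr1n -expr2.
  have [a00|an0] := eqVneq a 0.
    by rewrite a00 invr0; lra.
  move=> h; apply: (le_trans h); rewrite le_eqVlt; apply/orP; left; apply/eqP.
  by field.
exists (block_mx (Num.sqrt a)%:M 0 ((Num.sqrt a)^-1 *: v^T) D').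
have sa2 : Num.sqrt a * Num.sqrt a = a by rewrite -expr2 sqr_sqrtr.
have sav : (Num.sqrt a * (Num.sqrt a)^-1) *: v = v.
  have [a00|an0] := eqVneq a 0; first by rewrite v0// scaler0.
  by rewrite divff ?scale1r// sqrtr_eq0 -ltNge lt_neqAle eq_sym an0.
rewrite [LHS]AE tr_block_mx mulmx_block !tr_scalar_mx trmx0 !mul0mx !mulmx0 !addr0.
rewrite linearZ /= trmxK; congr block_mx.
- by rewrite -scalar_mxM sa2.
- by rewrite mul_scalar_mx scalerA sav.
- by rewrite mul_mx_scalar scalerA -{1}sav linearZ.
rewrite -D'E -scalemxAl -scalemxAr scalerA -invfM sa2.
by rewrite addrC subrK.
Qed.

Lemma spd_det_gt0 n (A : 'M[R]_n) : A^T = A ->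
  (forall x, x != 0 -> 0 < quad A x) -> 0 < \det A.
Proof.
move=> AT Apos; have [x|D AE] := psd_factor AT.
  have [->|x0] := eqVneq x 0; first by rewrite /quad mul0mx mul0mx mxE.
  exact/ltW/Apos.
rewrite AE det_mulmx det_tr -expr2 lt_neqAle sqr_ge0 andbT eq_sym sqrf_eq0.
apply/negP => /det0P[x x0 xD]; have := Apos x x0.
by rewrite /quad AE mulmxA xD !mul0mx mxE ltxx.
Qed.

(** A weak form of Hadamard's inequality: each of the [n!] terms of the
    determinant is a product of [n] entries, and every entry is at most the
    Frobenius norm. *)
Lemma sqr_det_le n (F : 'M[R]_n) :
  (\det F) ^+ 2 <= n`!%:R ^+ 2 * (\tr (F *m F^T)) ^+ n.
Proof.
have trE : \tr (F *m F^T) = \sum_i \sum_j F i j ^+ 2.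
  apply: eq_bigr => i _; rewrite mxE; apply: eq_bigr => j _.
  by rewrite [F^T _ _]mxE expr2.
have tr0 : 0 <= \tr (F *m F^T).
  by rewrite trE; apply: sumr_ge0 => i _; apply: sumr_ge0 => j _; exact: sqr_ge0.
pose m := Num.sqrt (\tr (F *m F^T)).
have Fm i j : `|F i j| <= m.
  rewrite -sqrtr_sqr /m ler_sqrt// trE (bigD1 i)//= (bigD1 j)//= -addrA lerDl.
  rewrite addr_ge0// sumr_ge0// => [k _|k _]; first exact: sqr_ge0.
  by apply: sumr_ge0 => l _; exact: sqr_ge0.
have dm : `|\det F| <= n`!%:R * m ^+ n.
  apply: (le_trans (ler_norm_sum _ _ _)).
  apply: (@le_trans _ _ (\sum_(s : {perm 'I_n}) m ^+ n)); last first.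
    by rewrite sumr_const mulr_natl card_Sn.
  apply: ler_sum => s _; rewrite normrM normrX normrN1 expr1n mul1r normr_prod.
  rewrite -[n in leRHS]card_ord -prodr_const; apply: ler_prod => i _.
  by rewrite normr_ge0 Fm.
rewrite -real_normK ?num_real// (le_trans (lerXn2r 2 _ _ dm))// ?nnegrE//.
  by rewrite mulr_ge0// exprn_ge0// sqrtr_ge0.
by rewrite exprMn -[m ^+ n ^+ 2]exprM mulnC exprM sqr_sqrtr.
Qed.

(** Writing [A = C C^T] and [B = D D^T], both sides are functions of the single
    matrix [F = C^T D]: [det A det B = det F ^ 2] and [tr (A B)] is the sum of
    the squares of the entries of [F]. *)
Lemma det_mul_le_trace n (A B : 'M[R]_n) : A^T = A -> B^T = B ->
  (forall x, 0 <= quad A x) -> (forall x, 0 <= quad B x) ->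
  [/\ 0 <= \det B, 0 <= \tr (A *m B) &
      \det A * \det B <= n`!%:R ^+ 2 * (\tr (A *m B)) ^+ n].
Proof.
move=> AT BT /(psd_factor AT)[C AE] /(psd_factor BT)[D BE].
have dB : \det B = \det D ^+ 2 by rewrite BE det_mulmx det_tr expr2.
have dA : \det A = \det C ^+ 2 by rewrite AE det_mulmx det_tr expr2.
have trE : \tr (A *m B) = \tr ((C^T *m D) *m (C^T *m D)^T).
  by rewrite AE BE trmx_mul trmxK -!mulmxA mxtrace_mulC -!mulmxA.
have := sqr_det_le (C^T *m D); rewrite -trE det_mulmx det_tr exprMn dA dB => h.
split => //; first exact: sqr_ge0.
rewrite trE; apply: sumr_ge0 => i _; rewrite mxE; apply: sumr_ge0 => j _.
by rewrite [X in _ * X]mxE -expr2 sqr_ge0.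
Qed.

End PositiveMatrices.

(** * The area inequality *)

Section AreaInequality.
Context {R : realType} {n : nat}.
Implicit Types (G : 'rV[R]_n.+1 -> 'rV[R]_n.+1) (V E A : set 'rV[R]_n.+1).

(** Indexed to act on row vectors from the right. *)
Definition jacobian G (x : 'rV[R]_n.+1) : 'M[R]_n.+1 :=
  \matrix_(i, j) partial i (fun z => G z ord0 j) x.

Lemma cvg_det (T : Type) (F : set_system T) (M : T -> 'M[R]_n.+1) (M0 : 'M[R]_n.+1) :
  Filter F -> (forall i j, M x i j @[x --> F] --> M0 i j) ->
  \det (M x) @[x --> F] --> \det M0.
Proof.
move=> FF MM0; rewrite /determinant.
apply: cvg_big => [|s _]; first exact: add_continuous.
 apply: cvgM; first exact: cvg_cst.
by apply: cvg_big => [|i _]; [exact: mul_continuous|exact: MM0].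
Qed.

(** Near [x0], the image of a cube of side [s] lies within [eta s] of its image
    under the linearisation of [G] at [x0]. *)
Lemma image_measure_le_local G V x0 (e : R) :
  (forall j, Ck_on 1 V (fun x => G x ord0 j)) -> open V -> V x0 -> 0 < e ->
  exists2 r, 0 < r & forall A, A `<=` ball x0 r -> (lebesgue_outer A < +oo)%E ->
    (lebesgue_outer (G @` A) <=
     (`|\det (jacobian G x0)| + e)%:E * lebesgue_outer A)%E.
Proof.
move=> GC oV Vx0 e0; set T := jacobian G x0.
have [eta eta0 heta] := lebesgue_outer_thickened_cube T e0.
have hj (j : 'I_n.+1) : exists d, 0 < d /\
    forall x y, ball x0 d x -> ball x0 d y ->
    `|G x ord0 j - G y ord0 j - ((x - y) *m T) ord0 j| <= eta * `|x - y|.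
  have [d d0 [_ hd]] := strict_diff (GC j) oV Vx0 eta0.
  exists d; split => // x y xd yd; rewrite mxE.
  rewrite (eq_bigr (fun i => (x - y) ord0 i * partial i (fun z => G z ord0 j) x0)).
    exact: hd.
  by move=> i _; rewrite [T _ _]mxE.
have [d hd] := choice hj.
pose r := \big[Num.min/1]_i d i.
have r0 : 0 < r by apply: lt_bigmin => // i _; have [] := hd i.
have rd i : r <= d i by exact: bigmin_le_cond.
exists r => //; apply: image_measure_le_of_cubes; first by rewrite addr_ge0// ltW.
move=> c s s0.
have [->|/set0P[y [yc yr]]] := eqVneq (box (cube c s) `&` ball x0 r) set0.
  rewrite image_set0 lebesgue_outer0 lee_fin mulr_ge0 ?addr_ge0 ?(ltW e0)//.
  by rewrite exprn_ge0// ltW.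
apply: (heta c (G y - (y - c) *m T)) => // _ [x [xc xr] <-]; exists x => //.
have -> : G x - (G y - (y - c) *m T) - (x - c) *m T = G x - G y - (x - y) *m T.
  have -> : (x - y) *m T = (x - c) *m T - (y - c) *m T.
    by rewrite -mulmxBl opprB addrA subrK.
  by rewrite !opprB !addrA [_ + _ - G y]addrAC.
apply: norm_le_coord; first by rewrite mulr_ge0// ltW.
move=> j.
have -> : (G x - G y - (x - y) *m T) ord0 j =
    G x ord0 j - G y ord0 j - ((x - y) *m T) ord0 j by rewrite !mxE.
apply: (le_trans ((hd j).2 x y (le_ball (rd j) xr) (le_ball (rd j) yr))).
rewrite ler_pM2l//.
apply: norm_le_coord; first exact: ltW.
move=> i; rewrite !mxE ler_norml; have := xc i; have := yc i; rewrite /= !mxE.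
by move=> /andP[h1 h2] /andP[h3 h4]; apply/andP; split; lra.
Qed.

(** The set is cut along the rational boxes on which [G] is close to an affine
    map and the Jacobian is nearly constant. On each piece a constant between
    the Jacobian and [H + 2 e] serves both as a bound for the image and as a
    lower bound for the integrand. *)
Lemma area_inequality G V E (H : 'rV[R]_n.+1 -> R) :
  (forall j, Ck_on 1 V (fun x => G x ord0 j)) -> open V -> E `<=` V ->
  measurable (E : set (leb_rV R n)) -> (lebesgue_outer E < +oo)%E ->
  measurable_fun (E : set (leb_rV R n)) (H : leb_rV R n -> R) ->
  (forall x, E x -> `|\det (jacobian G x)| <= H x) ->
  (lebesgue_outer (G @` E) <= \int[lebesgue_rV R n]_(x in E) (H x)%:E)%E.
Proof.
move=> GC oV EV mE Eoo mH JH; apply/lee_addgt0Pr => e' e'0.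
have Efin : lebesgue_outer E \is a fin_num by rewrite ge0_fin_numE ?lebesgue_outer_ge0.
have E0 : 0 <= fine (lebesgue_outer E) by rewrite fine_ge0// lebesgue_outer_ge0.
pose e := e' / 2 / (fine (lebesgue_outer E) + 1).
have e0 : 0 < e by rewrite !divr_gt0// ltr_wpDl.
have Je x0 : V x0 -> \forall x \near x0,
    `| `|\det (jacobian G x0)| - `|\det (jacobian G x)| | <= e.
  move=> Vx0.
  have c : `|\det (jacobian G x)| @[x --> nbhs x0] --> `|\det (jacobian G x0)|.
    apply: cvg_norm; apply: cvg_det => i j; rewrite mxE.
    rewrite (_ : (fun x => _) = partial i (fun z => G z ord0 j)); last first.
      by apply/funext => x; rewrite mxE.
    by have [_ /(_ i)[_ [h _]]] := GC j; exact: h.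
  by move/(@cvgrPdist_le _ _ _ (nbhs x0) (nbhs_filter x0)) : c; exact.
pose B k := box (@rat_box R n k).
pose good k (K : R) := 0 <= K /\ (forall A, A `<=` B k -> (lebesgue_outer A < +oo)%E ->
    (lebesgue_outer (G @` A) <= K%:E * lebesgue_outer A)%E) /\
  forall x, E x -> B k x -> K <= H x + e + e.
have cover x0 : V x0 -> exists k, B k x0 /\ exists K, good k K.
  move=> Vx0; have [r r0 hr] := image_measure_le_local GC oV Vx0 e0.
  have [k kx0 kB] := nbhs_rat_box (filterI (nbhsx_ballx x0 r r0) (Je x0 Vx0)).
  exists k; split => //; exists (`|\det (jacobian G x0)| + e); split.
    by rewrite addr_ge0// ltW.
  split => [A AB|x Ex /kB[_ /=]]; first by apply: hr => x /AB /kB[].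
  by rewrite ler_norml => /andP[_ h]; have := JH x Ex; lra.
have hex k : exists K, (exists K', good k K') -> good k K.
  have [[K hK]|no] := pselect (exists K, good k K); first by exists K.
  by exists 0.
have [K hK] := choice hex.
pose F k := if pselect (exists K, good k K) then B k else set0.
have FB k : F k `<=` B k by rewrite /F; case: pselect => [h x //|h x []].
have Fgood k x : F k x -> exists K, good k K by rewrite /F; case: pselect => [//|h []].
have VF : V `<=` \bigcup_k F k.
  move=> x /cover[k [kx hk]]; exists k => //; rewrite /F; by case: pselect => [h|h].
have mF k : measurable (F k : set (leb_rV R n)).
  by rewrite /F; case: pselect => [h|h]; [exact: box_measurable|exact: measurable0].
pose D := seqDU F; have mD k : measurable (D k : set (leb_rV R n)).
  apply: measurableD => //; rewrite -bigcup_mkord; exact: bigcup_measurable.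
have DF k : D k `<=` F k by move=> x [].
pose ED k := E `&` D k.
have mED k : measurable (ED k : set (leb_rV R n)) by exact: measurableI.
have EDE : E = \bigcup_k ED k.
  by rewrite /ED -setI_bigcupr -seqDU_bigcup_eq; apply/esym/setIidl => x /EV/VF.
have tED : trivIset setT ED by apply: trivIset_setIl; exact: trivIset_seqDU.
have H0 x : E x -> 0 <= H x by move=> /JH; exact: le_trans.
have mHe : measurable_fun (E : set (leb_rV R n)) (EFin \o (fun x : leb_rV R n => H x + e + e)).
  apply/measurable_EFinP; apply: measurable_funD; last exact: measurable_cst.
  by apply: measurable_funD; last exact: measurable_cst.
have He0 x : E x -> (0 <= (H x + e + e)%:E)%E.
  by move=> /H0 h; rewrite lee_fin !addr_ge0// ltW.
apply: (@le_trans _ _ (\int[lebesgue_rV R n]_(x in E) (H x + e + e)%:E)%E).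
  rewrite {1}EDE image_bigcup; apply: (le_trans (outer_measure_sigma_subadditive _ _)).
  rewrite [in leRHS]EDE ge0_integral_bigcup//=; first last.
  - by rewrite -EDE.
  - by rewrite -EDE.
  apply: lee_nneseries => [k _ _|k _]; first exact: lebesgue_outer_ge0.
  (* the constant [K k] is meaningful only if the piece is nonempty *)
  have [->|/set0P[x0 [Ex0 Dx0]]] := eqVneq (ED k) set0.
    by rewrite image_set0 lebesgue_outer0 integral_set0.
  have [K0 [KA KH]] := hK k (Fgood k x0 (DF _ _ Dx0)).
  have EDoo : (lebesgue_outer (ED k) < +oo)%E.
    by apply: le_lt_trans Eoo; apply: le_lebesgue_outer => x [].
  apply: (le_trans (KA _ _ EDoo)); first by move=> x [_ /DF/FB].
  rewrite -(integral_cst (lebesgue_rV R n) (mED k)).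
  apply: ge0_le_integral => //.
  - by apply: (measurable_funS mE _ mHe) => x [].
  - by move=> x [Ex /DF/FB Bx]; rewrite lee_fin; exact: KH.
have -> : (\int[lebesgue_rV R n]_(x in E) (H x + e + e)%:E =
    \int[lebesgue_rV R n]_(x in E) (H x)%:E +
    \int[lebesgue_rV R n]_(x in E) cst (e + e)%:E x)%E.
  rewrite -ge0_integralD//.
  - by apply: eq_integral => x _; rewrite -addrA EFinD.
  - exact/measurable_EFinP.
  - by move=> x _; rewrite lee_fin addr_ge0// ltW.
rewrite leeD2l// (integral_cst (lebesgue_rV R n) mE (e + e)%:E).
suff : ((e + e)%:E * lebesgue_outer E <= e'%:E)%E by [].
rewrite -(fineK Efin) -EFinM lee_fin /e.
have a1 : 0 < fine (lebesgue_outer E) + 1 by rewrite ltr_wpDl.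
set a := fine _ in E0 a1 *; have -> : e' / 2 / (a + 1) + e' / 2 / (a + 1) = e' / (a + 1).
  by field; rewrite gt_eqF.
by rewrite mulrAC ler_pdivrMr// ler_pM2l// lerDl.
Qed.

End AreaInequality.

(** * Euclidean length and contact points *)

Section EuclideanLength.
Context {R : realType} {n : nat}.
Implicit Types (p x y : 'rV[R]_n).

Lemma dotv_ge0 x : 0 <= dotv x x.
Proof. by apply: sumr_ge0 => i _; rewrite -expr2 sqr_ge0. Qed.

Lemma dotv_sqr_le p x : dotv p x ^+ 2 <= dotv p p * dotv x x.
Proof.
have [x0|x0] := eqVneq (dotv x x) 0.
  suff -> : dotv p x = 0 by rewrite expr0n /= x0 mulr0.
  apply: big1 => i _; move: x0 => /eqP; rewrite psumr_eq0 => [/allP h|j _]; last first.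
    by rewrite -expr2 sqr_ge0.
  have := h i (mem_index_enum i); rewrite /= mulf_eq0 orbb => /eqP ->.
  by rewrite mulr0.
have a0 : 0 < dotv x x by rewrite lt_neqAle eq_sym x0 dotv_ge0.
have : 0 <= \sum_i (dotv x x * p ord0 i - dotv p x * x ord0 i) ^+ 2.
  by apply: sumr_ge0 => i _; exact: sqr_ge0.
have E (a b : R) : \sum_i (a * p ord0 i - b * x ord0 i) ^+ 2 =
    a ^+ 2 * dotv p p - 2 * a * b * dotv p x + b ^+ 2 * dotv x x.
  rewrite /dotv !mulr_sumr -sumrB -big_split /=.
  by apply: eq_bigr => i _; ring.
rewrite {}E; set a := dotv x x in a0 *; set b := dotv p x.
have -> : a ^+ 2 * dotv p p - 2 * a * b * b + b ^+ 2 * a =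
  a * (dotv p p * a - b ^+ 2) by ring.
by rewrite pmulr_rge0// subr_ge0.
Qed.

Lemma enorm_ge0 x : 0 <= enorm x. Proof. exact: sqrtr_ge0. Qed.

Lemma sqr_enorm x : enorm x ^+ 2 = dotv x x.
Proof. by rewrite sqr_sqrtr// dotv_ge0. Qed.

Lemma normr_dotv_le p x : `|dotv p x| <= enorm p * enorm x.
Proof.
rewrite -(@ler_pXn2r _ 2)// ?nnegrE ?mulr_ge0 ?enorm_ge0//.
by rewrite real_normK ?num_real// exprMn !sqr_enorm dotv_sqr_le.
Qed.

Lemma enormD x y : enorm (x + y) <= enorm x + enorm y.
Proof.
rewrite -(@ler_pXn2r _ 2)// ?nnegrE ?addr_ge0 ?enorm_ge0//.
have -> : enorm (x + y) ^+ 2 = enorm x ^+ 2 + 2 * dotv x y + enorm y ^+ 2.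
  rewrite !sqr_enorm /dotv mulr_sumr -!big_split /=.
  by apply: eq_bigr => i _; rewrite mxE; ring.
have := le_trans (ler_norm _) (normr_dotv_le x y); rewrite sqrrD; lra.
Qed.

Lemma enorm_le_coord x m : 0 <= m -> (forall i, `|x ord0 i| <= m) -> enorm x <= n%:R * m.
Proof.
move=> m0 xm.
rewrite -(@ler_pXn2r _ 2)// ?nnegrE ?mulr_ge0 ?enorm_ge0// sqr_enorm.
apply: (@le_trans _ _ (\sum_(i < n) m ^+ 2)).
  apply: ler_sum => i _; rewrite -expr2 -real_normK ?num_real//.
  by rewrite ler_pXn2r ?nnegrE.
rewrite sumr_const card_ord -[X in X <= _]mulr_natl exprMn ler_wpM2r ?sqr_ge0//.
by rewrite -natrX ler_nat; case: (n) => // k; exact: leq_pmulr.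
Qed.

End EuclideanLength.

Section Contact.
Context {R : realType} {n : nat}.
Implicit Types (Omega V : set 'rV[R]_n) (u : 'rV[R]_n -> R) (x y p : 'rV[R]_n).

Lemma ediam_closure Omega x y : bounded_set Omega -> Omega x ->
  closure Omega y -> enorm (y - x) <= ediam Omega.
Proof.
move=> [M [_ /(_ (M + 1))]]; rewrite ltrDl ltr01 => /(_ isT) OM Ox Oy.
have hs z : Omega z -> enorm (z - x) <= ediam Omega.
  move=> Oz; apply: sup_upper_bound; last by exists z, x.
  split; first by exists (enorm (z - x)), z, x.
  exists (n%:R * (2 * (M + 1))) => _ [a [b [Oa Ob ->]]].
  have M0 : 0 <= M + 1 by exact: le_trans (OM _ Oa).
  apply: enorm_le_coord => [|i]; first lra.
  apply: (le_trans (coord_le_norm _ _)).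
  apply: (le_trans (ler_normB _ _)).
  by have := OM _ Oa; have := OM _ Ob; rewrite /=; lra.
apply/ler_addgt0Pr => e e0.
have e1 : 0 < e / (n%:R + 1) by rewrite divr_gt0// ltr_wpDl.
have [z [Oz]] := Oy _ (nbhsx_ballx y _ e1).
rewrite -ball_normE /= => /ltW yz.
have -> : y - x = (z - x) + (y - z) by rewrite [RHS]addrC addrA subrK.
apply: (le_trans (enormD _ _)); apply: lerD; first exact: hs.
apply: (@le_trans _ _ (n%:R * (e / (n%:R + 1)))).
  apply: enorm_le_coord => [|i]; first exact: ltW.
  exact: le_trans (coord_le_norm _ _) yz.
by rewrite mulrCA ger_pMr// ler_pdivrMr ?ltr_wpDl// mul1r lerDl.
Qed.

Lemma bounded_closure Omega : bounded_set Omega -> bounded_set (closure Omega).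
Proof.
move=> [M [_ /(_ (M + 1))]]; rewrite ltrDl ltr01 => /(_ isT) OM.
exists (M + 2); split; first exact: num_real.
move=> K MK y /(_ _ (nbhsx_ballx y _ ltr01))[z [/OM /= zM]].
rewrite -ball_normE /= => yz.
by rewrite -[y](subrK z) (le_trans (ler_normD _ _))//; lra.
Qed.

Lemma continuous_dotv p : continuous (dotv p).
Proof.
rewrite /dotv; apply: continuous_big => [|i _ x]; first exact: add_continuous.
by apply: continuousM; [exact: cst_continuous|exact: coord_continuous].
Qed.

(** Every slope that is small compared with the rise of [u] above its boundary
    values is the slope of a supporting plane: maximise [u - p . x]. *)
Lemma exists_contact Omega u x0 p S : open Omega -> bounded_set Omega ->
  {within closure Omega, continuous u} -> Omega x0 ->
  (forall x, boundary Omega x -> u x <= S) ->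
  enorm p * ediam Omega < u x0 - S ->
  exists y, [/\ Omega y, S < u y & forall x, Omega x -> u x <= u y + dotv p (x - y)].
Proof.
move=> oO bO cu Ox0 bS hp.
have cO : compact (closure Omega).
  apply: bounded_closed_compact; last exact: closed_closure.
  exact: bounded_closure.
have [] := @compact_EVT_max _ R (fun x => u x - dotv p x) (closure Omega) _ cO _.
- by exists x0; exact: subset_closure.
- move=> x; apply: cvgB; first exact: cu.
  by apply: continuous_subspaceT; exact: continuous_dotv.
move=> y; rewrite inE => yO ymax.
have dB x z : dotv p (x - z) = dotv p x - dotv p z.
  by rewrite /dotv -sumrB; apply: eq_bigr => i _; rewrite !mxE mulrBr.
have hx x : closure Omega x -> u x <= u y + dotv p (x - y).
  by move=> xO; have := ymax x; rewrite inE => /(_ xO); rewrite dB; lra.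
have h0 := hx x0 (subset_closure Ox0).
have h1 : dotv p (x0 - y) <= enorm p * ediam Omega.
  have -> : dotv p (x0 - y) = - dotv p (y - x0) by rewrite !dB opprB.
  apply: (le_trans (ler_norm _)); rewrite normrN.
  apply: (le_trans (normr_dotv_le _ _)).
  by rewrite ler_wpM2l ?enorm_ge0// ediam_closure.
have Sy : S < u y by lra.
exists y; split => //; last by move=> x Ox; apply: hx; exact: subset_closure.
have [//|nOy] := pselect (Omega y).
have : boundary Omega y by split => // /interior_subset.
by move=> /bS; rewrite leNgt Sy.
Qed.

Lemma open_restrict_preimage V (g : 'rV[R]_n -> R) (W : set R) : open V ->
  (forall x, V x -> {for x, continuous g}) -> open W -> open (V `&` g @^-1` W).
Proof.
move=> oV cg oW; rewrite openE => x [Vx Wx]; apply: filterI.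
  exact: (open_nbhs_nbhs (conj oV Vx)).
exact: (cg x Vx _ (open_nbhs_nbhs (conj oW Wx))).
Qed.

End Contact.

(** * The pointwise estimate on the contact set *)

Section PointwiseEstimate.
Context {R : realType} {n : nat}.
Implicit Types (Omega V : set 'rV[R]_n.+1) (u : 'rV[R]_n.+1 -> R)
  (a : 'rV[R]_n.+1 -> 'M[R]_n.+1) (b : 'rV[R]_n.+1 -> 'rV[R]_n.+1).

Definition grad u (x : 'rV[R]_n.+1) : 'rV[R]_n.+1 := \row_i partial i u x.

Lemma grad_coord u j : (fun x => grad u x ord0 j) = partial j u.
Proof. by apply/funext => x; rewrite mxE. Qed.

Lemma jacobian_grad u x i j : jacobian (grad u) x i j = partial i (partial j u) x.
Proof. by rewrite mxE grad_coord. Qed.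

Lemma Dstar_exp a x : 0 < \det (a x) -> Dstar a x ^+ n.+1 = \det (a x).
Proof.
move=> d0; rewrite -powR_mulrn ?powR_ge0// /Dstar -powRrM mulVf ?pnatr_eq0//.
by rewrite powRr1// ltW.
Qed.

Lemma elliptic_quad_gt0 V a x : elliptic_on V a -> V x ->
  forall v : 'rV[R]_n.+1, v != 0 -> 0 < quad (a x) v.
Proof.
move=> ell /ell[l [l0 hl]] v v0; rewrite quadE; apply: lt_le_trans (hl v).
rewrite mulr_gt0// sqr_enorm lt_neqAle dotv_ge0 andbT eq_sym.
apply: contra_neq v0 => h; apply/rowP => i; rewrite mxE; move: h => /eqP.
rewrite psumr_eq0 => [/allP/(_ i (mem_index_enum i))|j _].
  by rewrite /= mulf_eq0 orbb => /eqP.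
by rewrite -expr2 sqr_ge0.
Qed.

Lemma elliptic_det_gt0 V a x : (forall i j, a x i j = a x j i) ->
  elliptic_on V a -> V x -> 0 < \det (a x).
Proof.
move=> aS ell Vx; apply: spd_det_gt0; first by apply/matrixP => i j; rewrite mxE.
exact: elliptic_quad_gt0 ell Vx.
Qed.

Lemma Dstar_gt0 a x : 0 < \det (a x) -> 0 < Dstar a x.
Proof. by move=> d0; rewrite /Dstar powR_gt0. Qed.

(** Where [u] touches a supporting plane from below and is positive, the term
    [c u] is nonpositive and the differential inequality bounds
    [- tr (a D^2 u)], hence by [det_mul_le_trace] the determinant of the
    Hessian. *)
Lemma contact_jacobian_le Omega V u a b (c f : 'rV[R]_n.+1 -> R) y :
  open V -> V `<=` Omega -> Ck_on 2 V u -> V y -> elliptic_on V a ->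
  (forall i j, a y i j = a y j i) -> c y <= 0 -> f y <= Lop a b c u y ->
  0 < u y ->
  (forall x, Omega x -> u x <= u y + dotv (grad u y) (x - y)) ->
  `|\det (jacobian (grad u) y)| <= (n.+1)`!%:R ^+ 2 *
    (enorm (b y) / Dstar a y * enorm (grad u y) + negpart f y / Dstar a y) ^+ n.+1.
Proof.
move=> oV VO uC Vy ell aS cy fy uy hy.
pose A := a y; pose B := - jacobian (grad u) y.
have AT : A^T = A by apply/matrixP => i j; rewrite mxE.
have BT : B^T = B.
  by apply/matrixP => i j; rewrite !mxE !grad_coord (partial_comm _ _ uC oV Vy).
have Apos v : 0 <= quad A v.
  have [->|v0] := eqVneq v 0; first by rewrite /quad !mul0mx mxE.
  exact/ltW/(elliptic_quad_gt0 ell Vy).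
have Bpos v : 0 <= quad B v.
  rewrite quadE -oppr_le0 -sumrN.
  have := contact_hessian v uC oV VO Vy hy; congr (_ <= 0).
  apply: eq_bigr => i _; rewrite -sumrN; apply: eq_bigr => j _.
  by rewrite mxE jacobian_grad (partial_comm _ _ uC oV Vy); ring.
have [dB tr0 hdet] := det_mul_le_trace AT BT Apos Bpos.
have dA : 0 < \det A := elliptic_det_gt0 aS ell Vy.
have D0 := Dstar_gt0 dA.
have trE : \tr (A *m B) = - \sum_i \sum_j a y i j * partial i (partial j u) y.
  rewrite -sumrN; apply: eq_bigr => i _; rewrite mxE -sumrN; apply: eq_bigr => j _.
  by rewrite [B _ _]mxE jacobian_grad (partial_comm _ _ uC oV Vy) mulrN.
have bu : \sum_i b y ord0 i * partial i u y = dotv (b y) (grad u y).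
  by apply: eq_bigr => i _; rewrite mxE.
have tr1 : \tr (A *m B) <= enorm (b y) * enorm (grad u y) + negpart f y.
  move: fy; rewrite trE /Lop bu => fy.
  have h1 := le_trans (ler_norm _) (normr_dotv_le (b y) (grad u y)).
  have h2 : - f y <= negpart f y by rewrite /negpart le_max lexx.
  have h3 : c y * u y <= 0 by rewrite mulr_le0_ge0// ltW.
  lra.
have detJ : `|\det (jacobian (grad u) y)| = \det B.
  rewrite -(ger0_norm dB) /B -scaleN1r detZ normrM normrX normrN1 expr1n mul1r.
  by [].
have -> : enorm (b y) / Dstar a y * enorm (grad u y) + negpart f y / Dstar a y =
    (enorm (b y) * enorm (grad u y) + negpart f y) / Dstar a y.
  by rewrite mulrAC -mulrDl.
rewrite detJ expr_div_n Dstar_exp// mulrA ler_pdivlMr// mulrC.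
apply: (le_trans hdet); rewrite ler_wpM2l ?sqr_ge0//.
by rewrite lerXn2r// nnegrE (le_trans tr0).
Qed.

(** A supporting plane at a point of [V] can only have the gradient as its
    slope, so inside [V] the contact set is cut out by closed conditions. *)
Lemma contact_set_measurable Omega V u : open V -> V `<=` Omega ->
  upper_contact_set Omega u `<=` V -> Ck_on 1 V u ->
  measurable (upper_contact_set Omega u : set (leb_rV R n)).
Proof.
move=> oV VO GV uC; set G := upper_contact_set _ _.
have GE y : G y <-> V y /\ forall x, Omega x -> u x <= u y + dotv (grad u y) (x - y).
  split=> [Gy|[Vy hy]]; last by split; [exact: VO|exists (grad u y)].
  have Vy := GV _ Gy; split => //; have [_ [p hp]] := Gy.
  suff -> : grad u y = p by [].
  by apply/rowP => i; rewrite mxE (contact_gradient uC oV VO Vy hp).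
have oD : open (V `\` G).
  have -> : V `\` G = \bigcup_(x in Omega)
      (V `&` (fun y => u y + dotv (grad u y) (x - y)) @^-1` `]-oo, u x[%classic).
    apply/seteqP; split => [y [Vy nGy]|y [x Ox [Vy /=]]].
      apply: contrapT => hn; apply: nGy; apply/GE; split => // x Ox.
      rewrite leNgt; apply/negP => h; apply: hn; exists x => //; split => //=.
    rewrite in_itv /= => h; split => // /GE[_ /(_ x Ox)].
    by rewrite leNgt h.
  apply: bigcup_open => x Ox; apply: open_restrict_preimage => //.
  move=> y Vy; apply: continuousD; first by have [h _] := uC; exact: h.
  rewrite /dotv; apply: (cvg_big (@add_continuous _) (nbhs_filter y)) => i _.
  apply: continuousM.
    have [_ /(_ i)[_ [h _]]] := uC.
    rewrite (_ : (fun x => _) = partial i u); last by apply/funext => z; rewrite mxE.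
    exact: h.
  rewrite (_ : (fun z : 'rV[R]_n.+1 => (x - z) ord0 i) =
    (fun z : 'rV[R]_n.+1 => x ord0 i - z ord0 i)); last first.
    by apply/funext => z; rewrite !mxE.
  by apply: continuousB; [exact: cst_continuous|exact: coord_continuous].
have -> : G = V `\` (V `\` G) by rewrite setDD; apply/esym/setIidr.
by apply: measurableD; exact: open_lebesgue_measurable.
Qed.

End PointwiseEstimate.

(** * Norms as integrals *)

Section LpNorms.
Context {R : realType} {n : nat}.
Implicit Types (A : set 'rV[R]_n.+1) (g : 'rV[R]_n.+1 -> R).
Let mu := lebesgue_rV R n.
Let Ln : \bar R := (n.+1%:R)%:E.

Lemma Lp_norm_ge0 p A g : 0 <= Lp_norm p A g.
Proof. by apply: fine_ge0; exact: Lnorm_ge0. Qed.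

Lemma Lnorm_exp A g : measurable (A : set (leb_rV R n)) ->
  ((Lnorm mu Ln (EFin \o (g \_ A))) `^ n.+1%:R =
   \int[mu]_(x in A) (`|g x| ^+ n.+1)%:E)%E.
Proof.
move=> mA; rewrite /Ln poweR_Lnorm ?pnatr_eq0// [RHS]integral_mkcond.
apply: eq_integral => x _; rewrite /= !patchE; case: ifPn => xA.
  by rewrite powR_mulrn.
by rewrite /point /= normr0 powR0// pnatr_eq0.
Qed.

(** [Lp_norm] is a real number that is meaningless for an infinite norm, hence
    the finiteness hypothesis. *)
Lemma Lp_norm_exp A g : measurable (A : set (leb_rV R n)) ->
  (\int[mu]_(x in A) (`|g x| ^+ n.+1)%:E < +oo)%E ->
  (\int[mu]_(x in A) (`|g x| ^+ n.+1)%:E = (Lp_norm Ln A g ^+ n.+1)%:E)%E.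
Proof.
move=> mA; rewrite -Lnorm_exp// /Lp_norm.
have := Lnorm_ge0 mu Ln (EFin \o (g \_ A)).
rewrite -/mu; case: (Lnorm _ _ _) => [r r0 _|_|//].
  by rewrite poweR_EFin powR_mulrn.
by rewrite poweRyr ?pnatr_eq0// ltxx.
Qed.

Lemma in_Lp_integral_lty A g : measurable (A : set (leb_rV R n)) ->
  in_Lp Ln A g -> (\int[mu]_(x in A) (`|g x| ^+ n.+1)%:E < +oo)%E.
Proof.
by move=> mA [_ h]; rewrite -Lnorm_exp// poweR_lty.
Qed.

Lemma in_Lp_norm_exp A g : measurable (A : set (leb_rV R n)) -> in_Lp Ln A g ->
  (\int[mu]_(x in A) (`|g x| ^+ n.+1)%:E = (Lp_norm Ln A g ^+ n.+1)%:E)%E.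
Proof. by move=> mA /(in_Lp_integral_lty mA); exact: Lp_norm_exp. Qed.

Lemma measurable_norm_exp A g : measurable_fun (A : set (leb_rV R n)) (g : leb_rV R n -> R) ->
  measurable_fun (A : set (leb_rV R n)) (EFin \o (fun x : leb_rV R n => `|g x| ^+ n.+1)).
Proof.
move=> mg; apply/measurable_EFinP; apply: measurable_funX.
exact: measurableT_comp.
Qed.

Lemma negpart_div_measurable A (f D : 'rV[R]_n.+1 -> R) : (forall x, A x -> 0 < D x) ->
  measurable_fun (A : set (leb_rV R n)) ((fun x => f x / D x) : leb_rV R n -> R) ->
  measurable_fun (A : set (leb_rV R n)) ((fun x => negpart f x / D x) : leb_rV R n -> R).
Proof.
move=> D0 mf.
apply: (@eq_measurable_fun _ _ _ _ _ (fun x : leb_rV R n => Num.max (- (f x / D x)) 0)).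
  move=> x; rewrite inE => /D0 Dx; rewrite /negpart maxr_pMl ?invr_ge0 ?(ltW Dx)//.
  by rewrite mul0r mulNr.
apply: measurable_maxr; last exact: measurable_cst.
exact: measurableT_comp.
Qed.

Lemma negpart_div_integral_lty A (f D : 'rV[R]_n.+1 -> R) :
  measurable (A : set (leb_rV R n)) -> (forall x, A x -> 0 < D x) ->
  in_Lp Ln A (fun x => f x / D x) ->
  (\int[mu]_(x in A) (`|negpart f x / D x| ^+ n.+1)%:E < +oo)%E.
Proof.
move=> mA D0 fL; apply: le_lt_trans (in_Lp_integral_lty mA fL).
have [mf _] := fL.
apply: ge0_le_integral => //.
- exact/measurable_norm_exp/negpart_div_measurable.
- exact: measurable_norm_exp.
move=> x _; rewrite lee_fin lerXn2r ?nnegrE// !normrM ler_wpM2r//.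
rewrite /negpart /Num.max; case: ifPn => _; first by rewrite normr0.
by rewrite normrN.
Qed.

End LpNorms.

(** * Counting dyadic cubes of gradients *)

Section DyadicCount.
Context {R : realType}.

(** An upper bound for the integral over the contact set of the majorant [H]
    below, when [B] is the norm of [|b| / D]. *)
Definition abp_total (n : nat) (B : R) : R :=
  n`!%:R ^+ 2 * 2 ^+ n * ((2 * n%:R) ^+ n * B ^+ n + 1).

(** More cubes than the total [abp_total] allows, each using up [2 ^- n]. *)
Definition abp_steps (n : nat) (B : R) : nat :=
  (Num.truncn (2 ^+ n * abp_total n B)).+1.

(** The factor [n] accounts for the Euclidean length of the gradients in a cube
    given by bounds on their coordinates. *)
Definition abp_const (n : nat) (B : R) : R := n%:R * 2 ^+ abp_steps n B.

Lemma exprD_le (k : nat) (x y : R) : 0 <= x -> 0 <= y ->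
  (x + y) ^+ k <= 2 ^+ k * (x ^+ k + y ^+ k).
Proof.
wlog xy : x y / x <= y => [hw x0 y0|x0 y0].
  have [xy|/ltW yx] := leP x y; first exact: hw.
  by rewrite addrC [x ^+ k + _]addrC; exact: hw.
apply: (@le_trans _ _ ((2 * y) ^+ k)).
  by rewrite lerXn2r ?nnegrE ?addr_ge0 ?mulr_ge0//; lra.
by rewrite exprMn ler_wpM2l ?exprn_ge0// lerDr exprn_ge0.
Qed.

(** The estimate is homogeneous: on the dyadic shell of size [t] the factor
    [t ^ k] comes out, and the inhomogeneous term [y] only improves as [t]
    grows above [m]. *)
Lemma dyadic_scaling (k : nat) (K N x y p t m : R) :
  0 <= K -> 0 <= x -> 0 <= y -> 0 <= p -> 0 < m -> m <= t ->
  p <= N * (2 * t) ->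
  K * (x * p + y) ^+ k <=
  t ^+ k * (K * 2 ^+ k * ((2 * N) ^+ k * x ^+ k + y ^+ k / m ^+ k)).
Proof.
move=> K0 x0 y0 p0 m0 mt pN.
have t0 : 0 < t := lt_le_trans m0 mt.
have -> : t ^+ k * (K * 2 ^+ k * ((2 * N) ^+ k * x ^+ k + y ^+ k / m ^+ k)) =
    K * (2 ^+ k * (t ^+ k * ((2 * N) ^+ k * x ^+ k + y ^+ k / m ^+ k))).
  by move: (_ + _ / _) (t ^+ k) (2 ^+ k) => Z A P; ring.
have pN0 : 0 <= N * (2 * t) by exact: le_trans pN.
rewrite ler_wpM2l//.
apply: (@le_trans _ _ ((x * (N * (2 * t)) + y) ^+ k)).
  apply: lerXn2r; rewrite ?nnegrE.
  - by rewrite addr_ge0// mulr_ge0.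
  - by rewrite addr_ge0// mulr_ge0.
  - by rewrite lerD2r ler_wpM2l.
apply: (le_trans (exprD_le _ _ _)) => //; first by rewrite mulr_ge0.
rewrite ler_wpM2l ?exprn_ge0// [leRHS]mulrDr; apply: lerD.
  rewrite -!exprMn le_eqVlt; apply/orP; left; apply/eqP; congr (_ ^+ _); ring.
rewrite mulrCA ler_peMr ?exprn_ge0// ler_pdivlMr ?exprn_gt0// mul1r.
by rewrite lerXn2r ?nnegrE ?(ltW m0) ?(ltW t0).
Qed.

Context (n : nat) (Omega V : set 'rV[R]_n.+1) (u : 'rV[R]_n.+1 -> R)
  (a : 'rV[R]_n.+1 -> 'M[R]_n.+1) (b : 'rV[R]_n.+1 -> 'rV[R]_n.+1)
  (c f : 'rV[R]_n.+1 -> R).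
Let Gamma := upper_contact_set Omega u.
Let Ln : \bar R := (n.+1%:R)%:E.
Let bD (x : 'rV[R]_n.+1) : R := enorm (b x) / Dstar a x.
Let fD (x : 'rV[R]_n.+1) : R := negpart f x / Dstar a x.
Context (oO : open Omega) (bO : bounded_set Omega)
  (cu : {within closure Omega, continuous u}) (oV : open V)
  (VO : V `<=` Omega) (GV : Gamma `<=` V) (uC : Ck_on 2 V u)
  (aS : forall x, V x -> forall i j, a x i j = a x j i)
  (ell : elliptic_on V a) (c0 : forall x, V x -> c x <= 0)
  (fL : forall x, V x -> f x <= Lop a b c u x)
  (bLn : in_Lp Ln Gamma bD) (fLn : in_Lp Ln Gamma (fun x => f x / Dstar a x)).

Let D0 x : Gamma x -> 0 < Dstar a x.
Proof. by move=> /GV Vx; apply: Dstar_gt0; exact: (elliptic_det_gt0 (aS Vx) ell). Qed.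

Let mG : measurable (Gamma : set (leb_rV R n)).
Proof. exact: contact_set_measurable (Ck_on_S uC). Qed.

(** Only gradients in an open cube of side [t] in the positive orthant are
    counted; positivity of [u] makes the zeroth order term favourable. *)
Let slab (t : R) : set 'rV[R]_n.+1 := Gamma `&` [set x | 0 < u x] `&`
  [set x | forall i, t < partial i u x < 2 * t].

Let slab_measurable t : measurable (slab t : set (leb_rV R n)).
Proof.
have -> : slab t = Gamma `&` ((V `&` u @^-1` `]0, +oo[%classic) `&`
    \bigcap_(i in [set: 'I_n.+1]) (V `&` partial i u @^-1` `]t, 2 * t[%classic)).
  apply/seteqP; split => x.
    move=> [[Gx ux] hx]; have Vx := GV Gx; split => //; split.
      by split => //=; rewrite in_itv/= andbT.
    by move=> i _; split => //=; rewrite in_itv/=; exact: hx.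
  move=> [Gx [[_ /=]]]; rewrite in_itv/= andbT => ux hx; split => //.
  by move=> i; have [_ /=] := hx i I; rewrite in_itv.
apply: measurableI => //; apply: measurableI.
  apply/open_lebesgue_measurable/open_restrict_preimage => //.
  by have [h _] := uC; exact: h.
apply: fin_bigcap_measurable => // i _.
apply/open_lebesgue_measurable/open_restrict_preimage => //.
by have [_ /(_ i)[_ [h _]]] := uC; exact: h.
Qed.

(** After division by [t ^ n], a bound for the Jacobian of the gradient on
    [slab t] that is the same for all [t >= m]. *)
Let H (m : R) (x : 'rV[R]_n.+1) : R := (n.+1)`!%:R ^+ 2 * 2 ^+ n.+1 *
  ((2 * n.+1%:R) ^+ n.+1 * `|bD x| ^+ n.+1 + `|fD x| ^+ n.+1 / m ^+ n.+1).

Let H_ge0 m x : 0 <= m -> 0 <= H m x.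
Proof.
move=> m0; rewrite /H mulr_ge0// ?addr_ge0 ?mulr_ge0 ?exprn_ge0//.
by rewrite invr_ge0 exprn_ge0.
Qed.

Let mfD : measurable_fun (Gamma : set (leb_rV R n)) (fD : leb_rV R n -> R).
Proof. by case: fLn => mf _; exact: (negpart_div_measurable D0 mf). Qed.

Let mH m : measurable_fun (Gamma : set (leb_rV R n)) (H m : leb_rV R n -> R).
Proof.
have mb : measurable_fun (Gamma : set (leb_rV R n)) (bD : leb_rV R n -> R).
  by have [] := bLn.
apply: measurable_funM; first exact: measurable_cst.
apply: measurable_funD; apply: measurable_funM.
- exact: measurable_cst.
- by apply: measurable_funX; exact: measurableT_comp.
- by apply: measurable_funX; exact: measurableT_comp.
- exact: measurable_cst.
Qed.

Let integral_H m : 0 < m -> Lp_norm Ln Gamma fD <= m ->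
  (\int[lebesgue_rV R n]_(x in Gamma) (H m x)%:E <=
   (abp_total n.+1 (Lp_norm Ln Gamma bD))%:E)%E.
Proof.
move=> m0 Fm.
have mb : measurable_fun (Gamma : set (leb_rV R n)) (bD : leb_rV R n -> R).
  by have [] := bLn.
pose k := (n.+1)`!%:R ^+ 2 * 2 ^+ n.+1 : R.
have k0 : 0 <= k by rewrite mulr_ge0// exprn_ge0.
have -> : (\int[lebesgue_rV R n]_(x in Gamma) (H m x)%:E =
  (k * (2 * n.+1%:R) ^+ n.+1)%:E * \int[lebesgue_rV R n]_(x in Gamma) (`|bD x| ^+ n.+1)%:E +
  (k / m ^+ n.+1)%:E * \int[lebesgue_rV R n]_(x in Gamma) (`|fD x| ^+ n.+1)%:E)%E.
  have mb1 := measurable_norm_exp mb; have mf1 := measurable_norm_exp mfD.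
  have k1 : 0 <= k * (2 * n.+1%:R) ^+ n.+1 by rewrite mulr_ge0// exprn_ge0.
  have k2 : 0 <= k / m ^+ n.+1 by rewrite divr_ge0// exprn_ge0// ltW.
  rewrite -!ge0_integralZl_EFin//.
  rewrite -ge0_integralD; last first.
  - exact: measurable_funeM.
  - by move=> x _; rewrite -EFinM lee_fin mulr_ge0// exprn_ge0.
  - exact: measurable_funeM.
  - by move=> x _; rewrite -EFinM lee_fin mulr_ge0// exprn_ge0.
  - exact: mG.
  apply: eq_integral => x _; rewrite -!EFinM -EFinD; congr EFin.
  by rewrite /H -/k; ring.
rewrite (in_Lp_norm_exp mG bLn) (Lp_norm_exp mG); last first.
  by apply: negpart_div_integral_lty => //; exact: D0.
rewrite -!EFinM -EFinD lee_fin /abp_total -/k -/Ln.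
rewrite [leRHS]mulrDr mulr1 mulrA lerD2l -mulrA ler_piMr//.
rewrite mulrC ler_pdivrMr ?exprn_gt0// mul1r.
by rewrite lerXn2r// nnegrE ?Lp_norm_ge0// ltW.
Qed.

(** Otherwise the gradients on the contact set would fill [abp_steps] consecutive
    dyadic cubes, and each of them uses up at least [2 ^- n] of the integral of
    [H m], which is at most [abp_total]. *)
Lemma contact_growth x0 S m : Omega x0 -> 0 <= S ->
  (forall x, boundary Omega x -> u x <= S) ->
  0 < m -> Lp_norm Ln Gamma fD <= m ->
  u x0 <= S + abp_const n.+1 (Lp_norm Ln Gamma bD) * ediam Omega * m.
Proof.
move=> Ox0 S0 bS m0 Fm; set B := Lp_norm _ _ bD.
have d0 : 0 <= ediam Omega.
  by apply: le_trans (enorm_ge0 (x0 - x0)) _; apply: ediam_closure => //; exact: subset_closure.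
rewrite leNgt; apply/negP => hu.
pose N := abp_steps n.+1 B; pose t (k : nat) := 2 ^+ k * m.
have t0 k : 0 < t k by rewrite mulr_gt0// exprn_gt0.
have tm k : m <= t k by rewrite ler_peMl ?(ltW m0)// exprn_ege1// ler1n.
have tS k : t k.+1 = 2 * t k by rewrite /t exprS mulrA.
have slab_lb k : (k < N)%N ->
    (((2^-1) ^+ n.+1)%:E <= \int[lebesgue_rV R n]_(x in slab (t k)) (H m x)%:E)%E.
  move=> kN; pose Q : set 'rV[R]_n.+1 := [set p | forall i, t k < p ord0 i < 2 * t k].
  have Qe (p : 'rV[R]_n.+1) : Q p -> enorm p <= n.+1%:R * (2 * t k).
    move=> Qp; apply: enorm_le_coord => [|i]; first by rewrite mulr_ge0// ltW.
    have := Qp i; have := t0 k => h1 /andP[h2 h3].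
    by rewrite ler_norml; apply/andP; split; lra.
  have sub : Q `<=` grad u @` slab (t k).
    move=> p Qp.
    have tN : 2 * t k <= 2 ^+ N * m.
      by rewrite -tS /t ler_pM2r// ler_eXn2l// ltr1n.
    have pd : enorm p * ediam Omega < u x0 - S.
      rewrite ltrBrDl; apply: le_lt_trans hu; rewrite lerD2l /abp_const -/N.
      rewrite mulrAC ler_wpM2r//; apply: (le_trans (Qe p Qp)).
      by rewrite -mulrA ler_wpM2l.
    have [y [Oy Sy hy]] := exists_contact oO bO cu Ox0 bS pd.
    have Gy : Gamma y by split => //; exists p.
    have gE := contact_gradient (Ck_on_S uC) oV VO (GV Gy) hy.
    exists y; last by apply/rowP => i; rewrite mxE gE.
    by split; [split => //=; exact: le_lt_trans Sy|move=> i; rewrite gE; exact: Qp].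
  have lb : (((t k / 2) ^+ n.+1)%:E <= lebesgue_outer (grad u @` slab (t k)))%E.
    (* a closed cube of half the side, concentric with [Q] *)
    apply: (@lebesgue_outer_cube_ge _ _ (const_mx (t k + t k / 4))); first by rewrite divr_gt0.
    move=> x hx; apply: sub => i; have := hx i; rewrite mxE; have := t0 k.
    by move=> h1 /andP[h2 h3]; apply/andP; split; lra.
  have ub := @area_inequality R n (grad u) V (slab (t k)) (fun x => t k ^+ n.+1 * H m x).
  have {ub} ub : (lebesgue_outer (grad u @` slab (t k)) <=
      \int[lebesgue_rV R n]_(x in slab (t k)) (t k ^+ n.+1 * H m x)%:E)%E.
    apply: ub; [|exact: oV| |exact: slab_measurable| | |].
    - by move=> j; rewrite grad_coord; exact: Ck_on_partial.
    - by move=> x [[/GV]].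
    - apply: lebesgue_outer_bounded; have [M [Mr hM]] := bO.
      by exists M; split => // K /hM h x [[/GV/VO/h]].
    - apply: measurable_funM; first exact: measurable_cst.
      by apply: (measurable_funS mG _ (mH m)) => x [[]].
    move=> y [[Gy uy] gy]; have Vy := GV Gy.
    have [_ [p hp]] := Gy.
    have gE : grad u y = p.
      by apply/rowP => i; rewrite mxE (contact_gradient (Ck_on_S uC) oV VO Vy hp).
    apply: (le_trans (@contact_jacobian_le _ _ Omega V u a b c f y oV VO uC Vy ell
      (aS Vy) (c0 Vy) (fL Vy) uy _)); first by rewrite gE.
    have bD0 : 0 <= bD y by rewrite divr_ge0 ?enorm_ge0// ltW// D0.
    have fD0 : 0 <= fD y by rewrite divr_ge0 ?(ltW (D0 Gy))// le_max lexx orbT.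
    have gQ : enorm (grad u y) <= n.+1%:R * (2 * t k).
      by apply: Qe => i; rewrite mxE; exact: gy.
    have HE : H m y = (n.+1)`!%:R ^+ 2 * 2 ^+ n.+1 *
        ((2 * n.+1%:R) ^+ n.+1 * bD y ^+ n.+1 + fD y ^+ n.+1 / m ^+ n.+1).
      by rewrite /H (ger0_norm bD0) (ger0_norm fD0).
    rewrite HE; apply: dyadic_scaling;
      [exact: sqr_ge0|exact: bD0|exact: fD0|exact: enorm_ge0|exact: m0|exact: tm|].
    by apply: Qe => i; rewrite mxE; exact: gy.
  have tn0 : 0 < t k ^+ n.+1 by rewrite exprn_gt0.
  have mHs : measurable_fun (slab (t k) : set (leb_rV R n)) (H m : leb_rV R n -> R).
    by apply: (measurable_funS mG _ (mH m)) => x [[]].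
  move: (le_trans lb ub); under eq_integral do rewrite EFinM.
  rewrite ge0_integralZl_EFin; last first.
  - exact: ltW.
  - exact/measurable_EFinP.
  - by move=> x _; rewrite lee_fin H_ge0// ltW.
  - exact: slab_measurable.
  by rewrite exprMn EFinM lee_pmul2l// lte_fin.
have tri : trivIset [set` index_iota 0 N] (fun k => slab (t k)).
  have disj i j x : (i < j)%N -> slab (t i) x -> slab (t j) x -> False.
    move=> ij [_ /(_ ord0)/andP[_ h1]] [_ /(_ ord0)/andP[h2 _]].
    have := lt_trans h2 h1; rewrite -tS ltNge => /negP; apply.
    by rewrite /t ler_pM2r// ler_weXn2l// ler1n.
  move=> i j _ _ [x [xi xj]]; have [ij|ij|//] := ltngtP i j.
    by case: (disj _ _ _ ij xi xj).
  by case: (disj _ _ _ ij xj xi).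
have sum_le : (\sum_(0 <= k < N) \int[lebesgue_rV R n]_(x in slab (t k)) (H m x)%:E <=
    (abp_total n.+1 B)%:E)%E.
  have subG : \big[setU/set0]_(0 <= k < N) slab (t k) `<=` Gamma.
    by elim/big_ind: _ => [x []|A A' hA hA' x [/hA|/hA']|k _ x [[]]].
  have mU : measurable (\big[setU/set0]_(0 <= k < N) slab (t k) : set (leb_rV R n)).
    by apply: bigsetU_measurable.
  have H0 x : (0 <= (H m x)%:E)%E by rewrite lee_fin H_ge0// ltW.
  rewrite -(ge0_integral_bigsetU (lebesgue_rV R n) _ _ tri); last first.
  - by move=> x _; exact: H0.
  - by apply/measurable_EFinP; exact: (measurable_funS mG subG (mH m)).
  - exact: iota_uniq.
  - by move=> k; exact: slab_measurable.
  apply: le_trans (integral_H m0 Fm); apply: ge0_subset_integral.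
  - exact: mU.
  - exact: mG.
  - exact/measurable_EFinP.
  - by move=> x _; exact: H0.
  - exact: subG.
have : ((N%:R * (2^-1) ^+ n.+1)%:E <= (abp_total n.+1 B)%:E)%E.
  apply: le_trans sum_le; rewrite big_mkord.
  apply: (@le_trans _ _ (\sum_(k < N) ((2^-1) ^+ n.+1)%:E)%E).
    by rewrite sumEFin sumr_const card_ord mulr_natl.
  by apply: lee_sum => k _; exact: slab_lb.
rewrite lee_fin exprVn ler_pdivrMr ?exprn_gt0// mulrC.
by rewrite leNgt /N /abp_steps truncnS_gt.
Qed.

End DyadicCount.

Theorem theorem3p5 (R : realType) :
  exists C : nat -> R -> R,
  forall (n : nat) (Omega V : set 'rV[R]_n.+1)
    (u : 'rV[R]_n.+1 -> R)
    (a : 'rV[R]_n.+1 -> 'M[R]_n.+1) (b : 'rV[R]_n.+1 -> 'rV[R]_n.+1)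
    (c f : 'rV[R]_n.+1 -> R),
  let Gamma := upper_contact_set Omega u in
  let Ln : \bar R := (n.+1%:R)%:E in
  let bD : 'rV[R]_n.+1 -> R := fun x => enorm (b x) / Dstar a x in
  open Omega -> connected Omega -> Omega !=set0 -> bounded_set Omega ->
  smooth_boundary Omega ->
  {within closure Omega, continuous u} ->
  open V -> connected V -> V `<=` Omega -> Gamma `<=` V ->
  Ck_on 2 V u ->
  (forall i j, in_Linfty_loc V (fun x => a x i j)) ->
  (forall i, in_Lp +oo%E V (fun x => b x ord0 i)) ->
  in_Lp +oo%E V c ->
  (forall x, V x -> forall i j, a x i j = a x j i) ->
  elliptic_on V a ->
  (forall x, V x -> c x <= 0) ->
  (forall x, V x -> f x <= Lop a b c u x) ->
  in_Lp Ln Gamma bD ->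
  in_Lp Ln Gamma (fun x => f x / Dstar a x) ->
  sup (u @` Omega) <=
    sup (pospart u @` boundary Omega) +
    C n.+1 (Lp_norm Ln Gamma bD) * ediam Omega *
      Lp_norm Ln Gamma (fun x => negpart f x / Dstar a x).
Proof.
exists abp_const => n Omega V u a b c f Gamma Ln bD oO _ O0 bO _ cu oV _ VO GV uC
  _ _ _ aS ell c0 fL bLn fLn.
set S := sup (pospart u @` boundary Omega); set K := abp_const _ _ * _; set F := Lp_norm _ _ _.
have cO : compact (closure Omega).
  apply: bounded_closed_compact; last exact: closed_closure.
  exact: bounded_closure.
have [x1 Ox1] := O0.
have [y _ ymax] := compact_EVT_max (ex_intro _ x1 (subset_closure Ox1)) cO cu.
have bub : has_ubound (pospart u @` boundary Omega).
  exists (Num.max (u y) 0) => _ [x [xO _] <-].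
  by rewrite /pospart ge_max !le_max lexx orbT andbT ymax// inE.
have S0 : 0 <= S.
  have [e|/set0P[_ [x Bx _]]] := eqVneq (pospart u @` boundary Omega) set0.
    by rewrite /S e sup0.
  apply: (@le_trans _ _ (pospart u x)); first by rewrite le_max lexx orbT.
  by apply: sup_upper_bound; [split => //; exists (pospart u x)|]; exists x.
have bS x : boundary Omega x -> u x <= S.
  move=> Bx; apply: (@le_trans _ _ (pospart u x)); first by rewrite le_max lexx.
  by apply: sup_upper_bound; [split => //; exists (pospart u x)|]; exists x.
have F0 : 0 <= F by exact: Lp_norm_ge0.
have d0 : 0 <= ediam Omega.
  apply: le_trans (enorm_ge0 (x1 - x1)) _; apply: ediam_closure => //.
  exact: subset_closure.
have K0 : 0 <= K by rewrite mulr_ge0// mulr_ge0// exprn_ge0.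
apply: ge_sup; first by exists (u x1), x1.
move=> _ [x0 Ox0 <-]; apply/ler_addgt0Pr => e e0.
(* the slack [e] is spent on a level [m] above the possibly zero norm [F] *)
have K1 : 0 < K + 1 by rewrite ltr_wpDl.
have m0 : 0 < F + e / (K + 1) by rewrite ltr_wpDl// divr_gt0.
apply: (le_trans (contact_growth oO bO cu oV VO GV uC aS ell c0 fL bLn fLn Ox0 S0 bS m0 _)).
  by rewrite lerDl ltW// divr_gt0.
rewrite -/K mulrDr addrA lerD2l mulrCA ger_pMr// ler_pdivrMr// mul1r.
by rewrite lerDl.
Qed.
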